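(* Let $k$ be a field of characteristic zero and let $\mathcal{H}_c,\mathcal{H}_o$ be $\mathbb{Z}$-graded $k$-vector spaces. An OCHA structure on the pair $(\mathcal{H}_c,\mathcal{H}_o)$ is equivalent to a degree one coderivation $D\in\mathrm{Coder}^1(\Lambda^c\mathcal{H}_c\otimes T^c\mathcal{H}_o)$ such that $D^2=0$.
   Context: All vector spaces are $\mathbb{Z}$-graded over $k$. Koszul convention: $(f\otimes g)(x\otimes y)=(-1)^{|g||x|}f(x)\otimes g(y)$. In exponents of $-1$ an element stands for its degree. For $\sigma\in S_n$, $(-1)^{\epsilon(\sigma)}$ is the Koszul sign of $x_1\otimes\cdots\otimes x_n\mapsto(-1)^{\epsilon(\sigma)}x_{\sigma(1)}\otimes\cdots\otimes x_{\sigma(n)}$. $\mathfrak{S}_{a,b}$ is the set of $(a,b)$-unshuffles: $\sigma\in S_{a+b}$ with $\sigma(1)<\cdots<\sigma(a)$ and $\sigma(a+1)<\cdots<\sigma(a+b)$. $L_\infty$-algebra: a graded vector space $V$ with degree one graded symmetric maps $l_n:V^{\otimes n}\to V$ ($n\ge1$) such that $l_1^2=0$ and for $n\ge2$ $$\sum_{k+l=n}\ \sum_{\sigma\in\mathfrak{S}_{k,l}}(-1)^{\epsilon(\sigma)}\,l_{1+l}(l_k(v_{\sigma(1)},\dots,v_{\sigma(k)}),v_{\sigma(k+1)},\dots,v_{\sigma(n)})=0 .$$ OCHA (open-closed homotopy algebra) structure on $(\mathcal{H}_c,\mathcal{H}_o)$: two sequences of degree one multilinear operations $l_n:\mathcal{H}_c^{\wedge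 n}\to\mathcal{H}_c$ ($n\ge1$) and $n_{p,q}:\mathcal{H}_c^{\wedge p}\otimes\mathcal{H}_o^{\otimes q}\to\mathcal{H}_o$ ($p+q\ge1$) such that $(\mathcal{H}_c,\{l_n\})$ is an $L_\infty$-algebra and, for all $v_1,\dots,v_n\in\mathcal{H}_c$ and $a_1,\dots,a_m\in\mathcal{H}_o$, $$\sum_{p+r=n,\ p\ge2}\ \sum_{\sigma\in\mathfrak{S}_{p,r}}(-1)^{\epsilon(\sigma)}n_{1+r,m}(l_p(v_{\sigma(1)},\dots,v_{\sigma(p)}),v_{\sigma(p+1)},\dots,v_{\sigma(n)},a_1,\dots,a_m)$$ $$+\sum_{p+r=n}\ \sum_{\sigma\in\mathfrak{S}_{p,r}}\ \sum_{i+j=m-s}(-1)^{\mu_{p,i}(\sigma)}n_{p,i+1+j}(v_{\sigma(1)},\dots,v_{\sigma(p)},a_1,\dots,a_i,n_{r,s}(v_{\sigma(p+1)},\dots,v_{\sigma(n)},a_{i+1},\dots,a_{i+s}),a_{i+s+1},\dots,a_m)=0,$$ where $$\mu_{p,i}(\sigma)=s+i+si+ms+\epsilon(\sigma)+s(v_{\sigma(1)}+\cdots+v_{\sigma(p)}+a_1+\cdots+a_i)+(a_1+\cdots+a_i)(v_{\sigma(p+1)}+\cdots+v_{\sigma(n)}).$$ Coalgebra: $\Lambda^c\mathcal{H}_c=\bigoplus_{p\ge0}\mathcal{H}_c^{\wedge p}$ is the graded symmetric coalgebra, $T^c\mathcal{H}_o=\bigoplus_{q\ge0}\mathcal{H}_o^{\otimes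 q}$ the tensor coalgebra with the deconcatenation coproduct, and $\Lambda^c\mathcal{H}_c\otimes T^c\mathcal{H}_o$ has coproduct $$\Delta((u_1\wedge\cdots\wedge u_m)\otimes(v_1\otimes\cdots\otimes v_n))=\sum_{0\le p\le m,\,0\le q\le n}\ \sum_{\sigma\in\mathfrak{S}_{p,m-p}}(-1)^{\epsilon(\sigma)+\eta(p,q)}\big((u_{\sigma(1)}\wedge\cdots\wedge u_{\sigma(p)})\otimes(v_1\otimes\cdots\otimes v_q)\big)\otimes\big((u_{\sigma(p+1)}\wedge\cdots\wedge u_{\sigma(m)})\otimes(v_{q+1}\otimes\cdots\otimes v_n)\big),$$ with $\eta(p,q)=(u_{\sigma(p+1)}+\cdots+u_{\sigma(m)})(v_1+\cdots+v_q)$, and counit $\varepsilon$ the projection onto $\mathcal{H}_c^{\wedge0}\otimes\mathcal{H}_o^{\otimes0}=k$. A coderivation of a coalgebra $C$ is a linear map $\phi:C\to C$ with $(\phi\otimes1+1\otimes\phi)\Delta=\Delta\phi$ and $\varepsilon\phi=0$; $\mathrm{Coder}^1(C)$ is the space of those of degree one for the internal degree (the one induced by the gradings of $\mathcal{H}_c$ and $\mathcal{H}_o$). The correspondence meant is lifting: the operations $\{l_n\}$, $\{n_{p,q}\}$ are lifted to coderivations and summed, $D=\mathfrak{l}+\mathfrak{n}=\sum\hat l_n+\sum\hat n_{p,q}$. Here, for $f:\mathcal{H}_c^{\wedge p}\otimes\mathcal{H}_o^{\otimes q}\to\mathcal{H}_o$ and $r\ge p$, $s\ge q$, $$\hat f((u_1\wedge\cdots\wedge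 u_r)\otimes(v_1\otimes\cdots\otimes v_s))=\sum_{\sigma\in\mathfrak{S}_{r-p,p},\ 0\le j\le s-q}(-1)^{\mu}(u_{\sigma(1)}\wedge\cdots\wedge u_{\sigma(r-p)})\otimes(v_1\otimes\cdots\otimes v_j\otimes f(u_{\sigma(r-p+1)},\dots,u_{\sigma(r)},v_{j+1},\dots,v_{j+q})\otimes v_{j+q+1}\otimes\cdots\otimes v_s),$$ with $\mu=\epsilon(\sigma)+(u_{\sigma(1)}+\cdots+u_{\sigma(r-p)})+(v_1+\cdots+v_j)+(v_1+\cdots+v_j)(u_{\sigma(r-p+1)}+\cdots+u_{\sigma(r)})$, and $\hat f$ is zero otherwise. For $g:\mathcal{H}_c^{\wedge p}\to\mathcal{H}_c$, $\hat g$ vanishes if $n<p$, and for $n\ge p$ $$\hat g((u_1\wedge\cdots\wedge u_n)\otimes(v_1\otimes\cdots\otimes v_m))=\sum_{\sigma\in\mathfrak{S}_{p,n-p}}(-1)^{\epsilon(\sigma)}\big(g(u_{\sigma(1)}\wedge\cdots\wedge u_{\sigma(p)})\wedge u_{\sigma(p+1)}\wedge\cdots\wedge u_{\sigma(n)}\big)\otimes(v_1\otimes\cdots\otimes v_m).$$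
   Formalization: The sum with l_p runs over p≥1, not p≥2; the sign mu is the Koszul sign for degree-one operations (no s+i+si+ms, no factor s); and D must also satisfy D(1)=0 and, if dim H_o=1, preserve the span of words with an open letter (proved automatic otherwise). *)

(* Defs.v *)
From HB Require Import structures.
From mathcomp Require Import all_boot all_order all_fingroup all_algebra.
From mathcomp Require Import generic_quotient ring_quotient boolp.
From mathcomp.multinomials Require Import freeg.

Set Implicit Arguments.
Unset Strict Implicit.
Unset Printing Implicit Defensive.

Import GRing.Theory.
Local Open Scope ring_scope.
Local Open Scope quotient_scope.

Inductive span (k : fieldType) (V : lmodType k) (P : V -> Prop) : V -> Prop :=
| span0 : span P 0
| spanS (c : k) (x y : V) : P x -> span P y -> span P (c *: x + y).

Section SpanTheory.
Variables (k : fieldType) (V : lmodType k) (P : V -> Prop).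

Lemma spanD x y : span P x -> span P y -> span P (x + y).
Proof.
elim=> [|c u v Pu _ IHv] Py; first by rewrite add0r.
by rewrite -addrA; apply: spanS => //; apply: IHv.
Qed.

Lemma spanZ a x : span P x -> span P (a *: x).
Proof.
elim=> [|c u v Pu _ IHv]; first by rewrite scaler0; exact: span0.
by rewrite scalerDr scalerA; apply: spanS.
Qed.

Definition in_span : {pred V} := fun x => `[< span P x >].

Lemma in_span_zmod : zmod_closed in_span.
Proof.
split=> [|x y /asboolP Px /asboolP Py]; apply/asboolP; first exact: span0.
by apply: spanD Px _; rewrite -scaleN1r; apply: spanZ.
Qed.

HB.instance Definition _ := GRing.isZmodClosed.Build V in_span in_span_zmod.
End SpanTheory.

Section QuotientSpace.
Variables (k : fieldType) (V : lmodType k) (P : V -> Prop).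

Definition quotient_space : Type := {ideal_quot (in_span P)}.
HB.instance Definition _ := GRing.Zmodule.on quotient_space.

Definition quotient_proj (x : V) : quotient_space := \pi_{ideal_quot (in_span P)} x.

Let qscale (a : k) (x : quotient_space) : quotient_space :=
  quotient_proj (a *: repr (x : {ideal_quot (in_span P)})).

Let qscale_pi a x : qscale a (quotient_proj x) = quotient_proj (a *: x).
Proof.
apply/eqP; rewrite /qscale /quotient_proj -Quotient.idealrBE -scalerBr.
have: repr (\pi_{ideal_quot (in_span P)} x) - x \in in_span P.
  by rewrite Quotient.idealrBE reprK.
by move=> /asboolP Px; apply/asboolP/spanZ.
Qed.

Let proj_ex (x : quotient_space) : {y | x = quotient_proj y}.
Proof. by exists (repr (x : {ideal_quot (in_span P)})); rewrite /quotient_proj reprK. Qed.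

Let projD x y : quotient_proj (x + y) = quotient_proj x + quotient_proj y.
Proof. by rewrite /quotient_proj; apply: raddfD. Qed.

Let qscaleA a b v : qscale a (qscale b v) = qscale (a * b) v.
Proof. by have [y ->] := proj_ex v; rewrite !qscale_pi scalerA. Qed.

Let qscale1 : left_id 1 qscale.
Proof. by move=> v; have [y ->] := proj_ex v; rewrite qscale_pi scale1r. Qed.

Let qscaleDr : right_distributive qscale +%R.
Proof.
move=> a u v; have [x ->] := proj_ex u; have [y ->] := proj_ex v.
by rewrite -projD !qscale_pi scalerDr projD.
Qed.

Let qscaleDl v : {morph qscale^~ v : a b / a + b}.
Proof.
by move=> a b; have [y ->] := proj_ex v; rewrite !qscale_pi scalerDl projD.
Qed.

HB.instance Definition _ := GRing.Zmodule_isLmodule.Build k quotient_space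
  qscaleA qscale1 qscaleDr qscaleDl.

Lemma quotient_proj_is_linear : linear quotient_proj.
Proof. by move=> c x y; rewrite projD -qscale_pi. Qed.

HB.instance Definition _ := GRing.isLinear.Build k V quotient_space *:%R
  quotient_proj quotient_proj_is_linear.

Lemma quotient_proj_eq0 x : quotient_proj x = 0 <-> span P x.
Proof.
have := Quotient.idealrBE (in_span P) x 0; rewrite subr0 => E.
split=> [x0|Px].
  by apply/asboolP; rewrite -[X in is_true X]/(x \in in_span P) E; apply/eqP;
     rewrite -[LHS]/(quotient_proj x) x0 -(raddf0 quotient_proj).
rewrite -(raddf0 quotient_proj); apply/eqP.
by rewrite -[X in is_true X]E; apply/asboolP.
Qed.

End QuotientSpace.

Section Presentation.
Variables (k : fieldType) (X : choiceType) (R : {freeg X / k} -> Prop).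

Definition presented : Type := quotient_space R.
HB.instance Definition _ := GRing.Lmodule.on presented.

Definition generator (x : X) : presented := quotient_proj R << x >>.
End Presentation.

Section Tensor.
Variables (k : fieldType) (M N : lmodType k).

Inductive tensor_relation : {freeg (M * N)%type / k} -> Prop :=
| tensor_linl c x x' y :
    tensor_relation (<< (c *: x + x', y) >> - (c *: << (x, y) >> + << (x', y) >>))
| tensor_linr c x y y' :
    tensor_relation (<< (x, c *: y + y') >> - (c *: << (x, y) >> + << (x, y') >>)).

Definition tensor : Type := presented tensor_relation.
HB.instance Definition _ := GRing.Lmodule.on tensor.

Definition tens (x : M) (y : N) : tensor := generator tensor_relation (x, y).

Lemma tens_linl c x x' y : tens (c *: x + x') y = c *: tens x y + tens x' y.
Proof.
rewrite /tens /generator -linearP /=; apply/eqP; rewrite -subr_eq0 -raddfB.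
apply/eqP/quotient_proj_eq0.
rewrite -[X in span _ X]addr0 -[X in span _ (X + _)]scale1r.
by apply: spanS (span0 _); apply: tensor_linl.
Qed.

Lemma tens_linr c x y y' : tens x (c *: y + y') = c *: tens x y + tens x y'.
Proof.
rewrite /tens /generator -linearP /=; apply/eqP; rewrite -subr_eq0 -raddfB.
apply/eqP/quotient_proj_eq0.
rewrite -[X in span _ X]addr0 -[X in span _ (X + _)]scale1r.
by apply: spanS (span0 _); apply: tensor_linr.
Qed.
End Tensor.

Record gradedSpace (k : fieldType) := GradedSpace {
  gcarrier :> lmodType k;
  gdeg : int -> gcarrier -> Prop;
  gdeg0 : forall d, gdeg d 0;
  gdegP : forall d c x y, gdeg d x -> gdeg d y -> gdeg d (c *: x + y);
  gdeg_span : forall x, exists (s : seq int) (f : int -> gcarrier),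
    (forall d, gdeg d (f d)) /\ x = \sum_(d <- s) f d;
  gdeg_free : forall (s : seq int) (f : int -> gcarrier), uniq s ->
    (forall d, gdeg d (f d)) -> \sum_(d <- s) f d = 0 ->
    forall d, d \in s -> f d = 0 }.

(* [homogeneous d v]: the i-th entry of [v] has degree the i-th entry of [d]. *)
Definition homogeneous (k : fieldType) (H : gradedSpace k)
    (d : seq int) (v : seq H) : Prop :=
  size d = size v /\ forall i, (i < size v)%N -> gdeg d`_i v`_i.

Definition degsum (d : seq int) : int := \sum_(e <- d) e.

(* x_1, ..., x_n  |->  x_{s(1)}, ..., x_{s(n)} *)
Definition permute (V : zmodType) n (s : 'S_n) (x : seq V) : seq V :=
  [seq x`_(s i) | i <- enum 'I_n].

(* Exponent of the Koszul sign: one term for each inverted pair. *)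
Definition koszul n (s : 'S_n) (d : seq int) : int :=
  \sum_(i < n) \sum_(j < n | (i < j)%N && (s j < s i)%N) d`_(s i) * d`_(s j).

(* (a, n - a)-unshuffles, for a <= n; positions are counted from 0. *)
Definition unshuffle n (a : nat) (s : 'S_n) : bool :=
  [forall i : 'I_n, forall j : 'I_n,
     ((i < j) && ((j < a) || (a <= i)))%N ==> (s i < s j)%N].

Definition multilinear (k : fieldType) (V W : lmodType k) (f : seq V -> W) :=
  forall (a b : seq V) (c : k) (x y : V),
    f (a ++ (c *: x + y) :: b) = c *: f (a ++ x :: b) + f (a ++ y :: b).

Definition graded_symmetric (k : fieldType) (V : gradedSpace k) (W : lmodType k)
    (f : seq V -> W) :=
  forall (d : seq int) (v : seq V) (s : 'S_(size v)), homogeneous d v ->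
    f v = (-1) ^ koszul s d *: f (permute s v).

Section TensorSpaces.
Variables (k : fieldType) (H : gradedSpace k).

(* All the tensor powers together: the relations preserve the length. *)
Inductive multilinear_relation : {freeg (seq H) / k} -> Prop :=
| rel_lin c a b x y : multilinear_relation
    (<< a ++ (c *: x + y) :: b >> - (c *: << a ++ x :: b >> + << a ++ y :: b >>)).

Inductive symmetric_relation : {freeg (seq H) / k} -> Prop :=
| rel_mul r : multilinear_relation r -> symmetric_relation r
| rel_sym d v (s : 'S_(size v)) : homogeneous d v ->
    symmetric_relation (<< v >> - (-1) ^ koszul s d *: << permute s v >>).

Definition tensor_coalg : Type := presented multilinear_relation.
HB.instance Definition _ := GRing.Lmodule.on tensor_coalg.

Definition sym_coalg : Type := presented symmetric_relation.
HB.instance Definition _ := GRing.Lmodule.on sym_coalg.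

Definition tensor_word (v : seq H) : tensor_coalg :=
  generator multilinear_relation v.
Definition wedge_word (u : seq H) : sym_coalg := generator symmetric_relation u.
End TensorSpaces.

Section OCHA.
Variables (k : fieldType) (Hc Ho : gradedSpace k).

Definition coalg : Type := tensor (sym_coalg Hc) (tensor_coalg Ho).
HB.instance Definition _ := GRing.Lmodule.on coalg.

(* (u_1 /\ ... /\ u_m) (x) (v_1 (x) ... (x) v_n) *)
Definition word (u : seq Hc) (v : seq Ho) : coalg :=
  tens (wedge_word u) (tensor_word v).

Definition coalg_deg (e : int) : coalg -> Prop :=
  span (fun x => exists du u dv v, [/\ homogeneous du u, homogeneous dv v,
    degsum du + degsum dv = e & x = word u v]).

(* Maps out of [coalg] and of its tensor square are linear, hence determined  *)
(* by their values on homogeneous words, resp. on tensors of homogeneous      *)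
(* elements; they are specified by these values.                              *)

Definition is_coproduct (Delta : {linear coalg -> tensor coalg coalg}) : Prop :=
  forall du u dv v, homogeneous du u -> homogeneous dv v ->
  Delta (word u v) =
    \sum_(p < (size u).+1) \sum_(q < (size v).+1)
    \sum_(s : 'S_(size u) | unshuffle p s)
      (-1) ^ (koszul s du + degsum (drop p (permute s du)) * degsum (take q dv)) *:
      tens (word (take p (permute s u)) (take q v))
           (word (drop p (permute s u)) (drop q v)).

Definition is_counit (eps : {linear coalg -> k^o}) : Prop :=
  forall u v, eps (word u v) = (nilp u && nilp v)%:R.

(* T = f (x) g with the Koszul sign, g being of degree e. *)
Definition is_koszul_tensor (e : int) (f g : coalg -> coalg)
    (T : {linear tensor coalg coalg -> tensor coalg coalg}) : Prop :=
  forall d x y, coalg_deg d x -> T (tens x y) = (-1) ^ (e * d) *: tens (f x) (g y).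

Definition coder1 (Delta : {linear coalg -> tensor coalg coalg})
    (eps : {linear coalg -> k^o}) (phi : {linear coalg -> coalg}) : Prop :=
  [/\ exists T1 T2, [/\ is_koszul_tensor 0 phi id T1, is_koszul_tensor 1 id phi T2
        & forall x, T1 (Delta x) + T2 (Delta x) = Delta (phi x)],
      forall x, eps (phi x) = 0
    & forall e x, coalg_deg e x -> coalg_deg (e + 1) (phi x)].

(* A sequence of operations is packed into one function on lists, whose       *)
(* restriction to lists of length n (lengths p and q) is l_n (n_{p,q}); there *)
(* is no l_0 nor n_{0,0}, which is encoded by the value 0.                    *)
Definition closed_ops (l : seq Hc -> Hc) : Prop :=
  [/\ l [::] = 0, multilinear l, graded_symmetric l
    & forall d v, homogeneous d v -> gdeg (degsum d + 1) (l v)].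

Definition open_ops (n : seq Hc -> seq Ho -> Ho) : Prop :=
  [/\ n [::] [::] = 0,
      forall a, multilinear (n^~ a) /\ graded_symmetric (n^~ a),
      forall v, multilinear (n v)
    & forall d v e a, homogeneous d v -> homogeneous e a ->
        gdeg (degsum d + degsum e + 1) (n v a)].

Definition Linfty_relations (l : seq Hc -> Hc) : Prop :=
  (forall x, l [:: l [:: x]] = 0) /\
  forall d v, homogeneous d v -> (2 <= size v)%N ->
    \sum_(1 <= p < (size v).+1) \sum_(s : 'S_(size v) | unshuffle p s)
      (-1) ^ koszul s d *: l (l (take p (permute s v)) :: drop p (permute s v)) = 0.

(* All operations have degree one for the gradings in which the degrees d, e  *)
(* are taken, so the sign of the second sum is the Koszul sign of moving      *)
(* n_{r,t} across v_{s(1)}, ..., v_{s(p)}, a_1, ..., a_i and then             *)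
(* v_{s(p+1)}, ..., v_{s(n)} across a_1, ..., a_i. The terms p = 1 of the     *)
(* first sum are those of the differential l_1.                               *)
Definition open_closed_relations
    (l : seq Hc -> Hc) (n : seq Hc -> seq Ho -> Ho) : Prop :=
  forall d v e a, homogeneous d v -> homogeneous e a ->
    (\sum_(1 <= p < (size v).+1) \sum_(s : 'S_(size v) | unshuffle p s)
       (-1) ^ koszul s d *:
       n (l (take p (permute s v)) :: drop p (permute s v)) a)
    + (\sum_(p < (size v).+1) \sum_(s : 'S_(size v) | unshuffle p s)
       \sum_(t < (size a).+1) \sum_(i < (size a - t).+1)
         (-1) ^ (koszul s d + (degsum (take p (permute s d)) + degsum (take i e))
                 + degsum (take i e) * degsum (drop p (permute s d))) *:
         n (take p (permute s v))
           (take i a ++ n (drop p (permute s v)) (take t (drop i a))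
              :: drop (i + t) a)) = 0.

Definition ocha_ops (l : seq Hc -> Hc) (n : seq Hc -> seq Ho -> Ho) : Prop :=
  closed_ops l /\ open_ops n.

Definition ocha_relations (l : seq Hc -> Hc) (n : seq Hc -> seq Ho -> Ho) : Prop :=
  Linfty_relations l /\ open_closed_relations l n.

Definition ocha (l : seq Hc -> Hc) (n : seq Hc -> seq Ho -> Ho) : Prop :=
  ocha_ops l n /\ ocha_relations l n.

(* The lifts of l_p and n_{p,q}, on words of degrees du, dv. *)
Definition closed_lift (l : seq Hc -> Hc) (p : nat)
    (du : seq int) (u : seq Hc) (v : seq Ho) : coalg :=
  if (p <= size u)%N then
    \sum_(s : 'S_(size u) | unshuffle p s)
      (-1) ^ koszul s du *:
      word (l (take p (permute s u)) :: drop p (permute s u)) v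
  else 0.

Definition open_lift (n : seq Hc -> seq Ho -> Ho) (p q : nat)
    (du : seq int) (u : seq Hc) (dv : seq int) (v : seq Ho) : coalg :=
  if (p <= size u)%N && (q <= size v)%N then
    let r := (size u - p)%N in
    \sum_(s : 'S_(size u) | unshuffle r s) \sum_(j < (size v - q).+1)
      (-1) ^ (koszul s du + degsum (take r (permute s du)) + degsum (take j dv)
              + degsum (take j dv) * degsum (drop r (permute s du))) *:
      word (take r (permute s u))
           (take j v ++ n (drop r (permute s u)) (take q (drop j v))
              :: drop (j + q) v)
  else 0.

(* D = \sum_p \hat l_p + \sum_{p,q} \hat n_{p,q}; on a given word the lifts   *)
(* left out of the sums below vanish.                                         *)
Definition is_lift (l : seq Hc -> Hc) (n : seq Hc -> seq Ho -> Ho)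
    (D : {linear coalg -> coalg}) : Prop :=
  forall du u dv v, homogeneous du u -> homogeneous dv v ->
  D (word u v) =
    \sum_(1 <= p < (size u).+1) closed_lift l p du u v
    + \sum_(p < (size u).+1) \sum_(q < (size v).+1 | (0 < p + q)%N)
        open_lift n p q du u dv v.

(* The kernel of the projection onto Lambda^c Hc: words with an open letter.  *)
Definition open_part : coalg -> Prop :=
  span (fun x => exists u v, v <> [::] /\ x = word u v).

Definition open_stable (D : {linear coalg -> coalg}) : Prop :=
  forall x, open_part x -> open_part (D x).
End OCHA.

Definition one_dimensional (k : fieldType) (V : lmodType k) : Prop :=
  exists x : V, x <> 0 /\ forall y : V, exists c : k, y = c *: x.

(* Main.v *)
(* Every linear map out of the coalgebra C is determined by its values on words
   of homogeneous letters, and any family of values that is multilinear in the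
   letters and symmetric in the closed ones extends. On such words unshuffles
   with Koszul signs obey a recursion on the first letter, which makes the
   coproduct coassociative and cocommutative up to signs and shows that lifts
   are coderivations. The square of a degree one coderivation D is again a
   coderivation, and its components in Hc and Ho on words are the two families
   of relations. A coderivation with no component in Hc or Ho vanishes: by
   induction on the length its values are primitive, and in characteristic zero
   the primitive elements are the single letters. Hence D^2 = 0 is equivalent to
   the relations, and D is the lift of its components provided that it kills the
   unit and sends no word with an open letter into Lambda Hc. If Ho is not one
   dimensional, the latter is automatic: the component of D in Lambda Hc
   satisfies g(u; v_1 .. v_n) (x) v_(n+1) = +- g(u; v_2 .. v_(n+1)) (x) v_1, where
   v_(n+1) may be chosen independent of v_1. *)

From Pilot Require Import Defs.
From HB Require Import structures.
From mathcomp Require Import all_boot all_order all_fingroup all_algebra.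
From mathcomp Require Import generic_quotient ring_quotient boolp zify.
From mathcomp Require classical_sets.
From mathcomp.multinomials Require Import freeg.
Import Pilot.Defs.

Set Implicit Arguments.
Unset Strict Implicit.
Unset Printing Implicit Defensive.

Import GRing.Theory.
Local Open Scope ring_scope.

(** * Linear maps out of presented spaces and tensor products *)

(** Open stability is a genuine restriction. Let Ho be spanned by one letter v of even degree, so
    that its tensor coalgebra is cocommutative, and let c be a nonzero closed letter of degree |v| +
    1. The map sending u (x) v^n to (c /\ u) (x) v^(n-1), and u (x) 1 to 0, is a degree one
    coderivation of square zero that turns an open letter into a closed one, so it is not a lift.
    Likewise the counit condition allows a coderivation to send the unit to a single letter, which
    would be an operation l_0 or n_{0,0}.

    Sums over unshuffles in symmetric groups of varying size are awkward to split and regroup. The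
    sums [usum] and [csum] carry no permutation: coassociativity and cocommutativity become short
    inductions on a word, and permutations remain only where the definitions are met. *)

Lemma linear_pack (k : fieldType) (U V : lmodType k) (f : U -> V) :
  linear f -> exists F : {linear U -> V}, F =1 f.
Proof.
move=> lin_f; pose F : {linear U -> V} := HB.pack f (GRing.isLinear.Build k U V *:%R f lin_f).
by exists F.
Qed.

Section Spans.
Variables (k : fieldType) (V : lmodType k) (P : V -> Prop).

Lemma span_gen x : P x -> span P x.
Proof. by move=> Px; rewrite -[x]addr0 -[x]scale1r; apply: spanS (span0 _). Qed.

Lemma span_sum I (r : seq I) (Q : pred I) (F : I -> V) :
  (forall i, Q i -> span P (F i)) -> span P (\sum_(i <- r | Q i) F i).
Proof. by move=> PF; apply: (big_ind (span P)) => //; [exact: span0|exact: spanD]. Qed.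

Lemma span_trans (Q : V -> Prop) x :
  span P x -> (forall y, P y -> span Q y) -> span Q x.
Proof.
move=> Px PQ; elim: Px => [|c y z /PQ Py _ IH]; first exact: span0.
by apply: spanD IH; apply: spanZ.
Qed.

Lemma span_map (W : lmodType k) (f : {linear V -> W}) (Q : W -> Prop) x :
  span P x -> (forall y, P y -> span Q (f y)) -> span Q (f x).
Proof.
move=> Px PQ; elim: Px => [|c y z /PQ Py _ IH]; first by rewrite linear0; exact: span0.
by rewrite linearP; apply: spanD IH; apply: spanZ.
Qed.

Lemma span_eq (W : lmodType k) (f g : {linear V -> W}) x :
  (forall y, P y -> f y = g y) -> span P x -> f x = g x.
Proof. by move=> E; elim=> [|c y z Py _ IH]; rewrite ?linear0 // !linearP IH E. Qed.
End Spans.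

HB.instance Definition _ (k : fieldType) (X : choiceType) (W : lmodType k) (f : X -> W) :=
  GRing.isZmodMorphism.Build {freeg X / k} W (fglift f) (lift_is_additive f).

Section Presented.
Variables (k : fieldType) (X : choiceType) (R : {freeg X / k} -> Prop).

Lemma presented_span (x : presented R) :
  span (fun y => exists g, y = generator R g) x.
Proof.
have [y ->] : exists y, x = quotient_proj R y.
  by exists (repr (x : {ideal_quot (in_span R)})); rewrite /quotient_proj reprK.
rewrite -(freeg_sumE y) linear_sum; apply: span_sum => g _.
have -> : << coeff g y *g g >> = coeff g y *: << g >> :> {freeg X / k}.
  apply/eqP/freeg_eqP => h; rewrite coeffZ !coeffU mul1r //.
rewrite linearZ; apply/spanZ/span_gen; by exists g.
Qed.

(** [fglift f] kills the relations, hence their span, so its value at a chosen representative does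
    not depend on the choice. *)
Lemma presented_lift (W : lmodType k) (f : X -> W) :
  (forall r, R r -> fglift f r = 0) ->
  exists F : {linear presented R -> W}, forall g, F (generator R g) = f g.
Proof.
move=> fR.
(* [fglift] comes with additivity only. Expanding over any list that contains the support lets
   [c *: x] and [x] be compared on [dom x], even when [c = 0] empties the support of the former. *)
have fE s (z : {freeg X / k}) : {subset dom z <= s} -> uniq s ->
    fglift f z = \sum_(i <- s) coeff i z *: f i.
  move=> sub us; rewrite -{1}(freeg_sumE z) raddf_sum [RHS](bigID (mem (dom z))) /=.
  rewrite [X in _ = _ + X]big1 ?addr0; last by move=> i /coeff_outdom ->; rewrite scale0r.
  rewrite -[RHS]big_filter (eq_bigr _ (fun i _ => liftU _ _ _)).
  apply: perm_big; apply: uniq_perm; rewrite ?filter_uniq ?uniq_dom // => i.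
  by rewrite mem_filter; case: (boolP (i \in dom z)) => // /sub ->.
have fZ c x : fglift f (c *: x) = c *: fglift f x.
  rewrite !(fE (dom x)) ?uniq_dom //; last by apply: domZ_subset.
  by rewrite scaler_sumr; apply: eq_bigr => i _; rewrite coeffZ scalerA.
have fS x : span R x -> fglift f x = 0.
  elim=> [|c u v /fR fu _ IH]; first exact: raddf0.
  by rewrite raddfD /= fZ fu IH scaler0 addr0.
pose F (x : presented R) : W := fglift f (repr (x : {ideal_quot (in_span R)})).
have FE y : F (quotient_proj R y) = fglift f y.
  apply/eqP; rewrite -subr_eq0 -raddfB /=; apply/eqP/fS.
  by apply/asboolP; rewrite -[X in is_true X]/(_ \in in_span R) Quotient.idealrBE reprK.
have [|G GF] := @linear_pack k (presented R) W F.
  move=> c x y.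
  have E (z : presented R) : exists t, z = quotient_proj R t.
    by exists (repr (z : {ideal_quot (in_span R)})); rewrite /quotient_proj reprK.
  have [[u ->] [v ->]] := (E x, E y).
  by rewrite -linearP !FE raddfD /= fZ.
by exists G => g; rewrite GF FE liftU scale1r.
Qed.
End Presented.

Section TensorLift.
Variables (k : fieldType) (M N : lmodType k).

Lemma tensDl (x x' : M) (y : N) : tens (x + x') y = tens x y + tens x' y.
Proof. by rewrite -[x]scale1r tens_linl !scale1r. Qed.
Lemma tensDr (x : M) (y y' : N) : tens x (y + y') = tens x y + tens x y'.
Proof. by rewrite -[y]scale1r tens_linr !scale1r. Qed.
Lemma tens0l (y : N) : tens (0 : M) y = 0.
Proof. by apply: (addrI (tens 0 y)); rewrite -tensDl !addr0. Qed.
Lemma tens0r (x : M) : tens x (0 : N) = 0.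
Proof. by apply: (addrI (tens x 0)); rewrite -tensDr !addr0. Qed.
Lemma tensZl c (x : M) (y : N) : tens (c *: x) y = c *: tens x y.
Proof. by rewrite -[c *: x]addr0 tens_linl tens0l addr0. Qed.
Lemma tensZr c (x : M) (y : N) : tens x (c *: y) = c *: tens x y.
Proof. by rewrite -[c *: y]addr0 tens_linr tens0r addr0. Qed.

Lemma tensor_lift (W : lmodType k) (B : M -> N -> W) :
  (forall y, linear (B^~ y)) -> (forall x, linear (B x)) ->
  exists F : {linear tensor M N -> W}, forall x y, F (tens x y) = B x y.
Proof.
move=> Bl Br.
have [|F FE] := @presented_lift k _ (@tensor_relation k M N) W (fun p => B p.1 p.2).
  move=> r; case=> [c x x' y|c x y y'];
    have -> : forall a b, c *: << a >> + << b >> = << c *g a >> + << b >> :> {freeg (M * N)%type / k}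
      by [move=> a b; congr (_ + _); apply/eqP/freeg_eqP => h; rewrite coeffZ !coeffU mul1r].
    by rewrite raddfB raddfD /= !liftU /= !scale1r Bl subrr.
  by rewrite raddfB raddfD /= !liftU /= !scale1r Br subrr.
by exists F => x y; rewrite FE.
Qed.

Lemma tensor_span (P : M -> Prop) (Q : N -> Prop) :
  (forall x, span P x) -> (forall y, span Q y) ->
  forall t : tensor M N,
    span (fun t => exists x y, [/\ P x, Q y & t = tens x y]) t.
Proof.
move=> sP sQ t; apply: span_trans (presented_span t) _ => _ [[x y] ->].
rewrite -[generator _ _]/(tens x y).
elim: (sP x) => [|c x1 x2 Px _ IH]; first by rewrite tens0l; exact: span0.
rewrite tens_linl; apply: spanD IH; apply: spanZ.
elim: (sQ y) => [|d y1 y2 Qy _ IH]; first by rewrite tens0r; exact: span0.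
by rewrite tens_linr; apply: spanD IH; apply/spanZ/span_gen; exists x1, y1.
Qed.
End TensorLift.

(** * Homogeneous letters *)

Section Signs.
Variable k : fieldType.

Definition sg (e : int) : k := (-1) ^ e.
Definition par (e : int) : bool := odd `|e|.

Lemma sg_par e : sg e = (-1) ^+ par e.
Proof.
rewrite /sg /par; case: e => n; first by rewrite /= signr_odd.
by rewrite -[LHS]/((-1) ^- n.+1) -[absz _]/n.+1 signr_odd -exprVn invrN1.
Qed.

Lemma parD a b : par (a + b) = par a (+) par b.
Proof.
have parB (m n : nat) : par (m%:Z - n%:Z) = odd m (+) odd n.
  rewrite /par; case: (leqP n m) => [h|/ltnW h]; first by rewrite subzn // absz_nat oddB.
  by rewrite -opprB abszN subzn // absz_nat oddB // addbC.
case: a b => [m|m] [n|n].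
- by rewrite -PoszD /par !absz_nat oddD.
- by rewrite NegzE parB /par abszN !absz_nat.
- by rewrite NegzE addrC parB /par abszN !absz_nat addbC.
- by rewrite !NegzE -opprD -PoszD /par !abszN !absz_nat oddD.
Qed.

Lemma parM a b : par (a * b) = par a && par b.
Proof. by rewrite /par abszM oddM. Qed.

Lemma parN a : par (- a) = par a.
Proof. by rewrite /par abszN. Qed.

Lemma par0 : par 0 = false. Proof. by []. Qed.
Lemma par1 : par 1 = true. Proof. by []. Qed.

Definition parE := (parD, parM, parN, par0, par1).

Lemma sg_eq a b : par a = par b -> sg a = sg b.
Proof. by rewrite !sg_par => ->. Qed.

Lemma sg0 : sg 0 = 1. Proof. by []. Qed.

Lemma sgD a b : sg (a + b) = sg a * sg b.
Proof. by rewrite !sg_par parD signr_addb. Qed.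

Lemma sgZZ (V : lmodType k) a b (x : V) : sg a *: (sg b *: x) = sg (a + b) *: x.
Proof. by rewrite scalerA sgD. Qed.

Lemma sg0Z (V : lmodType k) (x : V) : sg 0 *: x = x.
Proof. by rewrite sg0 scale1r. Qed.
End Signs.
Arguments sg {k}.

(** A sign depends on its exponent only through [par], which turns sums into exclusive or and
    products into conjunction; a sign identity is settled by trying both parities of every
    degree. *)
Ltac par_cases := rewrite ?parE; repeat match goal with
  | |- context [par ?x] => case: (par x) end; by [].
Ltac signs := first [apply: sg_eq | congr (_ *: _); apply: sg_eq]; par_cases.

Section Letters.
Variables (k : fieldType) (H : gradedSpace k).

(* A vector together with a chosen degree, so that degrees need not be recovered
   from vectors (the zero vector has every degree). *)
Record letter := Letter { ldeg : int; lval : H; lhom : gdeg ldeg lval }.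

Definition vals (w : seq letter) : seq H := map lval w.
Definition degs (w : seq letter) : seq int := map ldeg w.
Definition deg (w : seq letter) : int := degsum (degs w).

Lemma deg_nil : deg [::] = 0. Proof. by rewrite /deg /degsum big_nil. Qed.
Lemma deg_cons x w : deg (x :: w) = ldeg x + deg w.
Proof. by rewrite /deg /degsum /= big_cons. Qed.
Lemma deg_cat a b : deg (a ++ b) = deg a + deg b.
Proof. by rewrite /deg /degsum /degs map_cat big_cat. Qed.
Definition degE := (deg_nil, deg_cat, deg_cons).

Lemma homogeneous_letters d v : homogeneous d v ->
  exists w, degs w = d /\ vals w = v.
Proof.
elim: v d => [|x v IH] [|e d] [] //= sz h; first by exists [::].
have [|w [<- <-]] := IH d; first by split=> [|i]; [case: sz | exact: (h i.+1)].
by exists (Letter (h 0 isT) :: w).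
Qed.

Lemma letters_homogeneous w : homogeneous (degs w) (vals w).
Proof.
split; first by rewrite !size_map.
elim: w => [|x w IH] [|i] //= h; first exact: lhom.
exact: IH.
Qed.

Lemma letters_decomp (x : H) : exists s : seq letter, x = \sum_(e <- s) lval e.
Proof.
have [s [f [hf ->]]] := gdeg_span x.
by exists [seq Letter (hf d) | d <- s]; rewrite big_map.
Qed.

Definition zero_letter d : letter := Letter (gdeg0 H d).

Lemma sum_by_degree (M : zmodType) (F : letter -> M) (D : seq int) s :
  uniq D -> all (fun e => ldeg e \in D) s ->
  \sum_(d <- D) \sum_(e <- s | ldeg e == d) F e = \sum_(e <- s) F e.
Proof.
move=> uD; elim: s => [_|x s IH /= /andP[xD /IH E]].
  by rewrite big_nil big1 // => d _; rewrite big_nil.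
rewrite big_cons -E.
have -> : F x = \sum_(d <- D | d == ldeg x) F x.
  by rewrite -big_filter filter_pred1_uniq // big_seq1.
rewrite [X in X + _]big_mkcond -big_split; apply: eq_bigr => d _ /=.
by rewrite big_cons eq_sym; case: eqP; rewrite ?add0r.
Qed.

Section Linear.
Variable W : lmodType k.

(** Letters are combined within one degree only. Any letter with the right degree and value is
    accepted as [z], so no particular proof of homogeneity is singled out. *)
Definition letter_comb c (x y z : letter) :=
  [/\ ldeg x = ldeg z, ldeg y = ldeg z & lval z = c *: lval x + lval y].

Definition letter_linear (g : letter -> W) :=
  forall c x y z, letter_comb c x y z -> g z = c *: g x + g y.

Definition letter_multilinear (f : seq letter -> W) :=
  forall a b, letter_linear (fun x => f (a ++ x :: b)).

Definition letter_symmetric (f : seq letter -> W) :=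
  forall a b x y,
    f (a ++ x :: y :: b) = sg (ldeg x * ldeg y) *: f (a ++ y :: x :: b).

(** A letter of value zero is the combination [1 z + z] of itself, whatever its degree. *)
Lemma letter_linear0 g z : letter_linear g -> lval z = 0 -> g z = 0.
Proof.
move=> lg z0; have := lg 1 z z z; rewrite scale1r => E; apply: (addrI (g z)).
by rewrite addr0 -E //; split=> //; rewrite z0 scaler0 addr0.
Qed.

(** By [grp] the letters of each degree merge into one letter that carries the sum of their values
    and of their images under [g]. Freeness of the grading makes each merged value zero. *)
Lemma letter_linear_sum0 g s : letter_linear g ->
  \sum_(e <- s) lval e = 0 -> \sum_(e <- s) g e = 0.
Proof.
move=> lg s0.
have grp t d : exists z, [/\ ldeg z = d, lval z = \sum_(e <- t | ldeg e == d) lval e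
    & g z = \sum_(e <- t | ldeg e == d) g e].
  elim: t => [|x t [z [zd zv zg]]].
    exists (zero_letter d); rewrite !big_nil; split=> //; exact: letter_linear0.
  rewrite !big_cons; case: eqP => [xd|_]; last by exists z.
  have hd : gdeg d (1 *: lval x + lval z).
    by apply: gdegP; [rewrite -xd | rewrite -zd]; exact: lhom.
  exists (Letter hd); split=> //=; first by rewrite zv scale1r.
  by rewrite (lg 1 x z) ?scale1r ?zg.
pose D := undup (degs s); have uD : uniq D := undup_uniq _.
have sD : all (fun e => ldeg e \in D) s.
  have -> : all (fun e => ldeg e \in D) s = all (mem D) (degs s) by rewrite all_map.
  by apply/allP => d; rewrite /= mem_undup.
pose f d := \sum_(e <- s | ldeg e == d) lval e.
have hf d : gdeg d (f d) by have [z [zd zv _]] := grp s d; rewrite /f -zv -zd; exact: lhom.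
have := gdeg_free uD hf; rewrite sum_by_degree // => /(_ s0) f0.
rewrite -(sum_by_degree _ uD sD) big_seq big1 // => d /f0 fd0.
by have [z [_ zv <-]] := grp s d; apply: letter_linear0 => //; rewrite zv.
Qed.

Definition decomp (x : H) : seq letter := projT1 (cid (letters_decomp x)).

Lemma decompE x : \sum_(e <- decomp x) lval e = x.
Proof. by rewrite /decomp; case: cid. Qed.

(** The choice made by [decomp] is immaterial: the letters of [decomp x] followed by the negatives
    of those of [s] add up to zero, so [letter_linear_sum0] applies. *)
Lemma decomp_sum g x s : letter_linear g -> x = \sum_(e <- s) lval e ->
  \sum_(e <- decomp x) g e = \sum_(e <- s) g e.
Proof.
move=> lg xs; apply/eqP; rewrite -subr_eq0; apply/eqP.
have opp_ex e : exists e', lval e' = - lval e /\ g e' = - g e.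
  have h : gdeg (ldeg e) (- lval e).
    by rewrite -[- _]addr0 -scaleN1r; apply: gdegP; [exact: lhom | exact: gdeg0].
  exists (Letter h); split => //; apply/eqP; rewrite -addr_eq0 -[g (Letter h)]scale1r.
  rewrite -(lg 1 (Letter h) e (zero_letter (ldeg e))) ?letter_linear0 //.
  by split=> //=; rewrite scale1r addNr.
have [opp oppE] := choice opp_ex.
rewrite -sumrN -(eq_bigr _ (fun e _ => (oppE e).2)) -(big_map opp xpredT g) -big_cat.
apply: letter_linear_sum0 => //; rewrite big_cat big_map /=.
by rewrite (eq_bigr _ (fun e _ => (oppE e).1)) sumrN decompE -xs subrr.
Qed.

Lemma decomp_lval g e : letter_linear g -> \sum_(e <- decomp (lval e)) g e = g e.
Proof. by move=> lg; rewrite (@decomp_sum _ _ [:: e]) ?big_seq1. Qed.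

Lemma decomp_linear g : letter_linear g -> linear (fun x => \sum_(e <- decomp x) g e).
Proof.
move=> lg c x y.
have scale_ex e : exists e', lval e' = c *: lval e /\ g e' = c *: g e.
  have h : gdeg (ldeg e) (c *: lval e).
    by rewrite -[c *: _]addr0; apply: gdegP; [exact: lhom | exact: gdeg0].
  exists (Letter h); split => //.
  rewrite (lg c e (zero_letter (ldeg e))); last by split=> //=; rewrite addr0.
  by rewrite (letter_linear0 (z := zero_letter _) lg) // addr0.
have [scl sclE] := choice scale_ex.
rewrite (@decomp_sum _ _ (map scl (decomp x) ++ decomp y)) //; last first.
  rewrite big_cat big_map /= (eq_bigr _ (fun e _ => (sclE e).1)).
  by rewrite -scaler_sumr !decompE.
by rewrite big_cat big_map /= (eq_bigr _ (fun e _ => (sclE e).2)) -scaler_sumr.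
Qed.

Fixpoint multilinear_ext (f : seq letter -> W) (v : seq H) : W :=
  if v is x :: v' then
    \sum_(e <- decomp x) multilinear_ext (fun w => f (e :: w)) v'
  else f [::].

Lemma multilinear_ext_comb c f g h v : (forall w, h w = c *: f w + g w) ->
  multilinear_ext h v = c *: multilinear_ext f v + multilinear_ext g v.
Proof.
elim: v f g h => [|x v IH] f g h E /=; first exact: E.
rewrite scaler_sumr -big_split; apply: eq_bigr => e _.
by apply: IH => w; exact: E.
Qed.

Lemma letter_multilinear_cons f x :
  letter_multilinear f -> letter_multilinear (fun w => f (x :: w)).
Proof. by move=> mf a b; exact: (mf (x :: a) b). Qed.

Lemma multilinear_ext_head f v : letter_multilinear f ->
  letter_linear (fun x => multilinear_ext (fun w => f (x :: w)) v).
Proof. by move=> mf c x y z xyz; apply: multilinear_ext_comb => w; exact: (mf [::]). Qed.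

Lemma multilinear_extP f : letter_multilinear f -> multilinear (multilinear_ext f).
Proof.
move=> mf a b c x y; elim: a f mf => [|z a IH] f mf /=.
  by rewrite (decomp_linear (multilinear_ext_head _ mf)).
rewrite scaler_sumr -big_split; apply: eq_bigr => e _.
by apply: IH; exact: letter_multilinear_cons.
Qed.

Lemma multilinear_ext_vals f w : letter_multilinear f -> multilinear_ext f (vals w) = f w.
Proof.
elim: w f => [|x w IH] f mf //=.
rewrite (decomp_lval x (multilinear_ext_head _ mf)) IH //.
exact: letter_multilinear_cons.
Qed.

Lemma multilinear_letters (f : seq H -> W) :
  multilinear f -> letter_multilinear (fun w => f (vals w)).
Proof. by move=> mf a b c x y z [_ _ E]; rewrite /vals !map_cat /= E mf. Qed.

Lemma multilinear_sum (f : seq H -> W) a b I (r : seq I) (F : I -> H) : multilinear f ->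
  f (a ++ \sum_(i <- r) F i :: b) = \sum_(i <- r) f (a ++ F i :: b).
Proof.
move=> mf; elim: r => [|i r IH].
  rewrite !big_nil; apply: (addrI (f (a ++ 0 :: b))).
  by rewrite addr0 -[X in X + _]scale1r -mf scale1r addr0.
by rewrite !big_cons -IH -[f (a ++ F i :: b)]scale1r -mf scale1r.
Qed.

(** Entries are replaced by sums of letters one at a time from the left; [a] is the part already
    replaced. *)
Lemma multilinear_eq (f g : seq H -> W) : multilinear f -> multilinear g ->
  (forall w, f (vals w) = g (vals w)) -> f =1 g.
Proof.
move=> mf mg E v; suff E1 : forall a, f (vals a ++ v) = g (vals a ++ v) by exact: (E1 [::]).
elim: v => [a|x v IH a]; first by rewrite cats0.
rewrite -(decompE x) !multilinear_sum //; apply: eq_bigr => e _.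
by have := IH (rcons a e); rewrite /vals map_rcons cat_rcons.
Qed.
End Linear.
End Letters.

(** * Unshuffles *)

Section PermutedSequences.
Variables (T : Type) (x0 : T).

Definition permseq n (s : 'S_n) (w : seq T) : seq T :=
  [seq nth x0 w (s i) | i <- enum 'I_n].

Lemma size_permseq n (s : 'S_n) w : size (permseq s w) = n.
Proof. by rewrite size_map size_enum_ord. Qed.

Lemma nth_permseq n (s : 'S_n) w (i : 'I_n) : nth x0 (permseq s w) i = nth x0 w (s i).
Proof. by rewrite (nth_map i) ?size_enum_ord // nth_ord_enum. Qed.

(** [lift_perm i ord0 s] puts the first letter in position [i] and fills the other positions
    according to [s]. This description of permutations drives all the recursions on the first
    letter. *)
Lemma permseq_lift n (i : 'I_n.+1) (s : 'S_n) x w :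
  permseq (lift_perm i ord0 s) (x :: w)
  = take i (permseq s w) ++ x :: drop i (permseq s w).
Proof.
have le_in : (i <= n)%N by rewrite -ltnS.
have sz : size (take i (permseq s w)) = i by rewrite size_takel ?size_permseq.
apply: (@eq_from_nth _ x0) => [|j].
  by rewrite size_permseq size_cat /= sz size_drop size_permseq addnS subnKC.
rewrite size_permseq => ltj; rewrite (nth_permseq _ _ (Ordinal ltj)) nth_cat sz.
case: (unliftP i (Ordinal ltj)) => [j'|] E; rewrite E.
  have -> : j = bump i j' by rewrite -[j]/(val (Ordinal ltj)) E.
  rewrite lift_perm_lift /= /bump; case: (leqP i j') => h.
    by rewrite add1n ltnNge leqW //= subSn //= nth_drop subnKC // nth_permseq.
  by rewrite add0n h nth_take // nth_permseq.
have -> : j = i by rewrite -[j]/(val (Ordinal ltj)) E.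
by rewrite lift_perm_id ltnn subnn.
Qed.
End PermutedSequences.

Lemma permseq_map T U (f : T -> U) x0 n (s : 'S_n) w :
  map f (permseq x0 s w) = permseq (f x0) s (map f w).
Proof.
rewrite -map_comp; apply: eq_map => i /=.
by case: (ltnP (s i) (size w)) => h; [rewrite (nth_map x0) | rewrite !nth_default ?size_map].
Qed.

Section LiftedPermutations.

(** Injectivity suffices, because (n+1) n! = (n+1)!. *)
Lemma lift_perm_bij n :
  bijective (fun p : 'I_n.+1 * 'S_n => lift_perm p.1 ord0 p.2).
Proof.
apply: inj_card_bij => [[i s] [j t] /= E|]; last first.
  by rewrite card_prod !card_Sn card_ord factS.
have ij : i = j.
  by apply: (@perm_inj _ (lift_perm j ord0 t)); rewrite -{1}E !lift_perm_id.
rewrite -{}ij in E *; congr (_, _); apply/permP => l.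
by apply: (@lift_inj _ ord0); rewrite -!(lift_perm_lift i) E.
Qed.

Lemma lift_permP n (s : 'S_n.+1) : exists i t, s = lift_perm i ord0 t.
Proof. by have [f _ fK] := lift_perm_bij n; exists (f s).1, (f s).2; rewrite fK. Qed.

Lemma lift_perm_sum (V : nmodType) n (F : 'S_n.+1 -> V) :
  \sum_s F s = \sum_(i < n.+1) \sum_(t : 'S_n) F (lift_perm i ord0 t).
Proof.
rewrite pair_bigA (reindex _ (onW_bij _ (lift_perm_bij n))) //.
Qed.

Lemma degsum_take n i (d : seq int) : size d = n -> (i <= n)%N ->
  degsum (take i d) = \sum_(j < n | (j < i)%N) d`_j.
Proof.
move=> sz lein; rewrite /degsum (big_nth 0) size_takel ?sz // big_mkord.
rewrite (big_ord_widen n (fun j => (take i d)`_j)) //.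
by apply: eq_bigr => j h; rewrite nth_take.
Qed.

(** The inverted pairs containing the first letter are those formed with the letters placed before
    it. *)
Lemma koszul_lift n (i : 'I_n.+1) (s : 'S_n) e d :
  koszul (lift_perm i ord0 s) (e :: d)
  = e * degsum (take i (permseq 0 s d)) + koszul s d.
Proof.
rewrite /koszul (bigD1_ord i) //= [X in X + _]big1 ?add0r; last first.
  by move=> j; rewrite lift_perm_id ltn0 andbF.
rewrite (degsum_take (n := n)) ?size_permseq -1?ltnS // mulr_sumr [X in _ = X + _]big_mkcond -big_split.
apply: eq_bigr => j _; rewrite big_mkcond (bigD1_ord i) //= lift_perm_id.
rewrite lift_perm_lift nth_permseq /= andbT.
have -> : (fintype.lift i j < i)%N = (j < i)%N.
  by rewrite /= /bump; lia.
congr (_ + _); first by case: ifP => // _; rewrite mulrC.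
rewrite [RHS]big_mkcond; apply: eq_bigr => l _.
by rewrite lift_perm_lift /= !ltnNge !leq_bump2 negbK.
Qed.

(** The first letter must head one of the two blocks, at position 0 or [p]. For [p = 0] these
    positions coincide and the first block is empty; the guard [0 < p] keeps the two cases
    disjoint. *)
Lemma unshuffle_lift n (i : 'I_n.+1) (s : 'S_n) p :
  unshuffle p (lift_perm i ord0 s)
  = ((i == 0 :> nat) && (0 < p)%N && unshuffle p.-1 s)
    || ((i == p :> nat) && unshuffle p s).
Proof.
apply/idP/idP.
  move=> U; have u (a b : 'I_n.+1) : (a < b)%N && ((b < p)%N || (p <= a)%N) ->
      (lift_perm i ord0 s a < lift_perm i ord0 s b)%N.
    by move=> h; move/forallP: U => /(_ a)/forallP/(_ b)/implyP/(_ h).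
  (* Otherwise position [i - 1] lies in the same block as [i], and monotonicity would send it below
     0. *)
  have ip : (i == 0 :> nat) && (0 < p)%N || (i == p :> nat).
    case: (posnP i) => i0; first by rewrite ?i0; case: (p).
    case: eqP => //= ip; have lt : (i.-1 < n.+1)%N by rewrite (leq_ltn_trans (leq_pred i)).
    suff /u : (Ordinal lt < i)%N && ((i < p)%N || (p <= Ordinal lt)%N).
      by rewrite lift_perm_id ltn0.
    by rewrite /=; lia.
  have {}ip : (i == p :> nat) || [&& i == 0 :> nat, (0 < p)%N & i != p :> nat].
    by move: ip; case: (i == p :> nat); rewrite ?orbT ?orbF // ?andbT.
  have sub q : (forall a b : 'I_n, (a < b)%N && ((b < q)%N || (q <= a)%N) ->
      (fintype.lift i a < fintype.lift i b)%N
      && ((fintype.lift i b < p)%N || (p <= fintype.lift i a)%N)) -> unshuffle q s.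
    move=> h; apply/forallP => a; apply/forallP => b; apply/implyP => /h /u.
    by rewrite !lift_perm_lift.
  case/orP: ip => [/eqP ip|/and3P[/eqP i0 p0 _]]; apply/orP; [right|left].
    rewrite ip eqxx /=; apply: sub => a b; rewrite /= /bump; lia.
  by rewrite i0 p0 /=; apply: sub => a b; rewrite /= /bump i0; lia.
have lp q : unshuffle q s -> (forall a b : 'I_n,
      (fintype.lift i a < fintype.lift i b)%N
      && ((fintype.lift i b < p)%N || (p <= fintype.lift i a)%N) ->
      (a < b)%N && ((b < q)%N || (q <= a)%N)) ->
    (forall a : 'I_n, ~~ ((fintype.lift i a < i)%N && ((i < p)%N || (p <= fintype.lift i a)%N))) ->
    unshuffle p (lift_perm i ord0 s).
  move=> U h1 h2; apply/forallP => a; apply/forallP => b; apply/implyP.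
  case: (unliftP i a) => [a'|] ->; case: (unliftP i b) => [b'|] ->.
  - move=> /h1; rewrite !lift_perm_lift; move/forallP: U => /(_ a')/forallP/(_ b')/implyP U /U.
    by rewrite /= /bump !leq0n !add1n ltnS.
  - by rewrite (negPf (h2 a')).
  - by rewrite lift_perm_id lift_perm_lift.
  - by rewrite ltnn.
case/orP => [/andP[/andP[/eqP i0 p0] U]|/andP[/eqP ip U]].
  by apply: lp U _ _ => [a b|a]; rewrite /= /bump i0; lia.
by apply: lp U _ _ => [a b|a]; rewrite /= /bump ip; lia.
Qed.
End LiftedPermutations.

(** * Signed sums over unshuffles: the coproduct of the symmetric coalgebra *)

Section UnshuffleSums.
Variables (k : fieldType) (H : gradedSpace k) (V : lmodType k).
Implicit Types (w a b : seq (letter H)) (F G : seq (letter H) -> seq (letter H) -> V).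

(* The sum of the [F a b] over all unshuffles of [w] into two blocks, with Koszul
   signs: the first letter of [w] goes to the front of [a], or else of [b] after
   crossing [a]. *)
Fixpoint usum w F : V :=
  if w is x :: w' then
    usum w' (fun a b => F (x :: a) b + sg (ldeg x * deg a) *: F a (x :: b))
  else F [::] [::].

(** The two blocks keep the total degree and length of [w]; sign computations use the first fact,
    inductions on the length the second. *)
Lemma eq_usum w F G :
  (forall a b, deg a + deg b = deg w -> (size a + size b = size w)%N -> F a b = G a b) ->
  usum w F = usum w G.
Proof.
elim: w F G => [|x w IH] F G E /=; first by rewrite E // deg_nil addr0.
apply: IH => a b dab sab; congr (_ + _ *: _); apply: E; rewrite /= -?sab ?addnS //.
  by rewrite !deg_cons -dab addrA.
by rewrite !deg_cons -dab addrCA.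
Qed.

Lemma usum_comb w c F G :
  usum w (fun a b => c *: F a b + G a b) = c *: usum w F + usum w G.
Proof.
elim: w F G => [|x w IH] F G //=; rewrite -IH; apply: eq_usum => a b _ _.
by rewrite !scalerDr !scalerA addrACA mulrC.
Qed.

Lemma usumD w F G : usum w (fun a b => F a b + G a b) = usum w F + usum w G.
Proof.
rewrite -[usum w F]scale1r -usum_comb; apply: eq_usum => a b _ _; by rewrite scale1r.
Qed.

Lemma usum0 w : usum w (fun _ _ => 0) = 0.
Proof.
by elim: w => [|x w IH] //=; rewrite -[RHS]IH; apply: eq_usum => a b _ _; rewrite scaler0 addr0.
Qed.

Lemma usumZ w c F : usum w (fun a b => c *: F a b) = c *: usum w F.
Proof.
rewrite -[RHS]addr0 -(usum0 w) -usum_comb; apply: eq_usum => a b _ _; by rewrite addr0.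
Qed.

(** Graded cocommutativity of the symmetric coalgebra. *)
Lemma usum_swap w F : usum w F = usum w (fun a b => sg (deg a * deg b) *: F b a).
Proof.
elim: w F => [|x w IH] F /=; first by rewrite deg_nil sg0Z.
rewrite IH; apply: eq_usum => a b _ _.
rewrite scalerDr addrC !deg_cons !sgZZ; congr (_ + _); signs.
Qed.

Lemma usum_extremel w F : (forall a x b, F (x :: a) b = 0) -> usum w F = F [::] w.
Proof.
elim: w F => [|x w IH] F F0 //=; rewrite IH.
  by rewrite F0 add0r deg_nil mulr0 sg0Z.
by move=> a y b; rewrite !F0 scaler0 addr0.
Qed.

Lemma usum_extremer w F : (forall a x b, F a (x :: b) = 0) -> usum w F = F w [::].
Proof.
elim: w F => [|x w IH] F F0 //=; rewrite IH; first by rewrite F0 scaler0 addr0.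
by move=> a y b; rewrite !F0 scaler0 addr0.
Qed.
End UnshuffleSums.

Section UnshuffleSumTheory.
Variables (k : fieldType) (H : gradedSpace k) (V : lmodType k).
Implicit Types (w a b : seq (letter H)).

(** Coassociativity of the symmetric coalgebra: both sides distribute the letters into three blocks,
    and in the proof the first letter joins each of the three in turn. *)
Lemma usum_assoc w (G : seq (letter H) -> seq (letter H) -> seq (letter H) -> V) :
  usum w (fun a b => usum a (fun a1 a2 => G a1 a2 b))
  = usum w (fun a b => usum b (fun b1 b2 => G a b1 b2)).
Proof.
elim: w G => [|x w IH] G //=.
transitivity (usum w (fun a b => usum a (fun a1 a2 =>
   G (x :: a1) a2 b + sg (ldeg x * deg a1) *: G a1 (x :: a2) b
   + sg (ldeg x * (deg a1 + deg a2)) *: G a1 a2 (x :: b)))).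
  apply: eq_usum => a b _ _; rewrite -usumZ -usumD; apply: eq_usum => a1 a2 <- _ //.
rewrite (IH (fun a1 a2 b => _)); apply: eq_usum => a b _ _.
rewrite -usumZ -usumD; apply: eq_usum => b1 b2 _ _.
by rewrite scalerDr addrA sgZZ mulrDr.
Qed.

Lemma usum_rotate w (G : seq (letter H) -> seq (letter H) -> seq (letter H) -> V) :
  usum w (fun a b => usum b (fun b1 b2 => G a b1 b2))
  = usum w (fun a b => usum b (fun b1 b2 => sg (deg a * deg b1) *: G b1 a b2)).
Proof.
rewrite -!usum_assoc; apply: eq_usum => a b _ _; exact: usum_swap.
Qed.

Lemma usum_linear (W : lmodType k) (f : {linear V -> W}) w F :
  f (usum w F) = usum w (fun a b => f (F a b)).
Proof.
elim: w F => [|x w IH] F //=; rewrite IH; apply: eq_usum => a b _ _.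
by rewrite linearD linearZ.
Qed.

Lemma usum_letter_comb w F1 F2 F3 (c : k) :
  (forall a b, F3 a b = c *: F1 a b + F2 a b) ->
  usum w F3 = c *: usum w F1 + usum w F2 :> V.
Proof. by move=> E; rewrite -usum_comb; apply: eq_usum => a b _ _. Qed.

(** Letters in front of the varying one are absorbed into [F], which keeps its hypotheses; the
    varying letter then stands at the front of a block. *)
Lemma usum_multilinear (F : seq (letter H) -> seq (letter H) -> V) :
  (forall b, letter_multilinear (F^~ b)) -> (forall a, letter_multilinear (F a)) ->
  letter_multilinear (fun w => usum w F).
Proof.
move=> Fl Fr p; elim: p F Fl Fr => [|z p IH] F Fl Fr q c x y t xyt /=.
  have [xt yt _] := xyt; apply: usum_letter_comb => a b.
  rewrite (Fl b [::] a _ _ _ _ xyt) (Fr a [::] b _ _ _ _ xyt) xt yt.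
  by rewrite !scalerDr !scalerA addrACA mulrC.
apply: (IH (fun a b => F (z :: a) b + sg (ldeg z * deg a) *: F a (z :: b))) => //
  [b|a] p' q' c' x' y' t' E /=.
  have [xt yt _] := E; rewrite (Fl b (z :: p') q' _ _ _ _ E) (Fl _ p' q' _ _ _ _ E).
  rewrite !degE xt yt.
  by rewrite !scalerDr !scalerA addrACA mulrC.
rewrite (Fr _ p' q' _ _ _ _ E) (Fr _ (z :: p') q' _ _ _ _ E).
by rewrite !scalerDr !scalerA addrACA mulrC.
Qed.

(** When both exchanged letters fall into one block, the symmetry of [F] applies. When they are
    separated, the exchange permutes the two mixed terms, and the sign comes from one letter
    crossing the other. *)
Lemma usum_symmetric (F : seq (letter H) -> seq (letter H) -> V) :
  (forall b, letter_symmetric (F^~ b)) -> (forall a, letter_symmetric (F a)) ->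
  letter_symmetric (fun w => usum w F).
Proof.
move=> Fl Fr p; elim: p F Fl Fr => [|z p IH] F Fl Fr q x y /=.
  rewrite -usumZ; apply: eq_usum => a b _ _.
  rewrite (Fl b [::] a x y) (Fr a [::] b x y) /= !deg_cons.
  rewrite !scalerDr !sgZZ -!addrA; congr (_ + _); rewrite [LHS]addrCA.
  by congr (_ + (_ + _)); signs.
apply: (IH (fun a b => F (z :: a) b + sg (ldeg z * deg a) *: F a (z :: b))) => [b|a] p' q' x' y' /=.
  rewrite (Fl b (z :: p') q' x' y') (Fl _ p' q' x' y') scalerDr !sgZZ !degE.
  by congr (_ + _); signs.
rewrite (Fr _ p' q' x' y') (Fr _ (z :: p') q' x' y') scalerDr !sgZZ.
by congr (_ + _); signs.
Qed.

(** By [unshuffle_lift] an unshuffle of the tail extends in exactly two ways, with the first letter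
    heading the first or the second block; these are the two terms in the recursion of [usum]. *)
Lemma usum_unshuffle n w (F : seq (letter H) -> seq (letter H) -> V) :
  size w = n ->
  \sum_(p < n.+1) \sum_(s : 'S_n | unshuffle p s)
    sg (koszul s (degs w)) *: F (take p (permseq (zero_letter H 0) s w))
                                (drop p (permseq (zero_letter H 0) s w))
  = usum w F.
Proof.
set z0 := zero_letter H 0.
elim: n w F => [|n IH] [|x w] F //= => [_|[sz]].
  rewrite big_ord_recl big_ord0 addr0 (big_pred1 1%g).
    rewrite /koszul big_ord0 sg0Z; congr (F _ _); by apply: size0nil; rewrite ?size_take ?size_drop size_permseq.
  move=> s; rewrite [s]permS0 /= eqxx. by apply/forallP; case.
rewrite -IH //.
pose G (p : nat) (s : 'S_n.+1) := sg (koszul s (degs (x :: w))) *: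
  F (take p (permseq z0 s (x :: w))) (drop p (permseq z0 s (x :: w))).
transitivity (\sum_(p < n.+1) \sum_(s : 'S_n | unshuffle p s)
   (G p.+1 (lift_perm ord0 ord0 s) + G p (lift_perm p ord0 s))); last first.
  apply: eq_bigr => p _; apply: eq_bigr => s _.
  have szp : size (permseq z0 s w) = n by rewrite size_permseq.
  have szt : size (take p (permseq z0 s w)) = p by rewrite size_takel // szp -ltnS.
  rewrite /G scalerDr sgZZ /= !koszul_lift !permseq_lift /= take0 drop0 /=.
  have takep l : take p (take p (permseq z0 s w) ++ l) = take p (permseq z0 s w).
    by rewrite take_cat szt ltnn subnn take0 cats0.
  have dropp l : drop p (take p (permseq z0 s w) ++ l) = l.
    by rewrite drop_cat szt ltnn subnn drop0.
  rewrite takep dropp take0 /degsum big_nil mulr0 add0r.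
  congr (_ + _); congr (_ *: _); rewrite addrC; congr (sg (_ + _ * _)).
  by rewrite /deg /degs map_take permseq_map.
(* The two alternatives of [unshuffle_lift] exclude each other, so they may be separate summands. *)
transitivity (\sum_(p < n.+2) \sum_(i < n.+1) \sum_(s : 'S_n)
   ((if (i == 0 :> nat) && (0 < p)%N && unshuffle p.-1 s then G p (lift_perm i ord0 s) else 0)
   + if (i == p :> nat) && unshuffle p s then G p (lift_perm i ord0 s) else 0)).
  apply: eq_bigr => p _; rewrite big_mkcond lift_perm_sum.
  apply: eq_bigr => i _; apply: eq_bigr => s _; rewrite unshuffle_lift.
  case: (boolP ((i == 0 :> nat) && (0 < p)%N && _)) => [|_] /=; last by rewrite add0r.
  by move=> /andP[/andP[/eqP -> p0] _]; rewrite (ltn_eqF p0) addr0.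
under eq_bigr do under eq_bigr do rewrite big_split.
under eq_bigr do rewrite big_split; rewrite big_split /=.
(* For [p = 0] the first letter cannot head the first block, and for [p = n + 1] it cannot head the
   second. Dropping these terms matches both ranges with [p < n + 1], the first after a shift by
   one. *)
under [RHS]eq_bigr do rewrite big_split; rewrite big_split /=; congr (_ + _).
  rewrite big_ord_recl [X in X + _]big1 ?add0r; last first.
    by move=> i _; rewrite big1 // => s _; rewrite andbF.
  apply: eq_bigr => p _; rewrite (bigD1 ord0) //= [X in _ + X]big1 ?addr0; last first.
    by move=> i i0; rewrite big1 // => s _; rewrite -val_eqE /= in i0; rewrite (negPf i0).
  by rewrite -big_mkcond; apply: eq_bigr.
rewrite big_ord_recr /= [X in _ + X]big1 ?addr0; last first.
  by move=> i _; rewrite big1 // => s _; rewrite ltn_eqF.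
apply: eq_bigr => p _; rewrite (bigD1 p) //= [X in _ + X]big1 ?addr0; last first.
  by move=> i ip; rewrite big1 // => s _; rewrite -val_eqE /= in ip; rewrite (negPf ip).
by rewrite eqxx -big_mkcond.
Qed.
End UnshuffleSumTheory.

(** * Sums over deconcatenations: the coproduct of the tensor coalgebra *)

Section CutSums.
Variables (k : fieldType) (T : Type) (V : lmodType k).
Implicit Types (v a b : seq T) (F G : seq T -> seq T -> V).

(* The sum of the [F a b] over all [a], [b] with [a ++ b = v]. *)
Fixpoint csum v F : V :=
  if v is y :: v' then F [::] v + csum v' (fun a b => F (y :: a) b)
  else F [::] [::].

Lemma eq_csum v F G :
  (forall a b, a ++ b = v -> F a b = G a b) -> csum v F = csum v G.
Proof.
elim: v F G => [|y v IH] F G E /=; first exact: E.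
rewrite E //; congr (_ + _); apply: IH => a b ab; by apply: E; rewrite /= ab.
Qed.

Lemma csum_comb v c F G :
  csum v (fun a b => c *: F a b + G a b) = c *: csum v F + csum v G.
Proof.
by elim: v F G => [|y v IH] F G //=; rewrite IH scalerDr addrACA.
Qed.

Lemma csumD v F G : csum v (fun a b => F a b + G a b) = csum v F + csum v G.
Proof.
by rewrite -[csum v F]scale1r -csum_comb; apply: eq_csum => a b _; rewrite scale1r.
Qed.

Lemma csum0 v : csum v (fun _ _ => 0) = 0.
Proof. by elim: v => [|y v IH] //=; rewrite IH addr0. Qed.

Lemma csumZ v c F : csum v (fun a b => c *: F a b) = c *: csum v F.
Proof.
by rewrite -[RHS]addr0 -(csum0 v) -csum_comb; apply: eq_csum => a b _; rewrite addr0.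
Qed.

Lemma csum_take_drop v F : csum v F = \sum_(q < (size v).+1) F (take q v) (drop q v).
Proof.
elim: v F => [|y v IH] F /=; first by rewrite big_ord_recl big_ord0 addr0.
by rewrite big_ord_recl IH.
Qed.

Lemma csum_assoc v (G : seq T -> seq T -> seq T -> V) :
  csum v (fun a b => csum a (fun a1 a2 => G a1 a2 b))
  = csum v (fun a b => csum b (fun b1 b2 => G a b1 b2)).
Proof.
by elim: v G => [|y v IH] G //=; rewrite csumD IH addrA.
Qed.

(** Applied with [y] the output of an operation: a cut falls on one side or the other of it. *)
Lemma csum_cat x y z F : csum (x ++ y :: z) F
  = csum x (fun x1 x2 => F x1 (x2 ++ y :: z)) + csum z (fun z1 z2 => F (x ++ y :: z1) z2).
Proof. by elim: x F => [|t x IH] F //=; rewrite IH addrA. Qed.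

Lemma csum_extremel v F : (forall y a b, F (y :: a) b = 0) -> csum v F = F [::] v.
Proof.
case: v => [|y v] F0 //=; rewrite (_ : csum _ _ = 0) ?addr0 //.
by rewrite -(csum0 v); apply: eq_csum.
Qed.

Lemma csum_extremer v F : (forall a y b, F a (y :: b) = 0) -> csum v F = F v [::].
Proof. by elim: v F => [|y v IH] F F0 //=; rewrite F0 add0r IH. Qed.

Lemma usum_csum (H : gradedSpace k) (w : seq (letter H)) v
    (F : seq (letter H) -> seq (letter H) -> seq T -> seq T -> V) :
  usum w (fun c d => csum v (F c d)) = csum v (fun x y => usum w (fun c d => F c d x y)).
Proof.
elim: v F => [|y v IH] F //=; rewrite usumD; congr (_ + _).
exact: (IH (fun c d x => F c d (y :: x))).
Qed.
End CutSums.

Lemma csum_linear (k : fieldType) (T : Type) (V W : lmodType k) (f : {linear V -> W})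
    (v : seq T) F :
  f (csum v F) = csum v (fun a b => f (F a b)).
Proof. by elim: v F => [|y v IH] F //=; rewrite linearD IH. Qed.

Lemma csum_multilinear (k : fieldType) (H : gradedSpace k) (V : lmodType k)
    (F : seq (letter H) -> seq (letter H) -> V) :
  (forall b, letter_multilinear (F^~ b)) -> (forall a, letter_multilinear (F a)) ->
  letter_multilinear (fun w => csum w F).
Proof.
move=> Fl Fr p; elim: p F Fl Fr => [|z p IH] F Fl Fr q c x y t E /=.
  rewrite (Fr [::] [::] q _ _ _ _ E) /=.
  rewrite (eq_csum (G := fun a b => c *: F (x :: a) b + F (y :: a) b)); last first.
    by move=> a b _; exact: (Fl b [::] a _ _ _ _ E).
  by rewrite csum_comb scalerDr addrACA.
rewrite (Fr [::] (z :: p) q _ _ _ _ E) /= (IH (fun a b => F (z :: a) b) _ _ q c x y t E) //.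
  by rewrite scalerDr addrACA.
by move=> b a' b'; exact: (Fl b (z :: a') b').
Qed.

(** * Words and linear maps out of the coalgebra *)

Section Words.
Variables (k : fieldType) (Hc Ho : gradedSpace k).
Local Notation C := (coalg Hc Ho).

Lemma presented_eq (X : choiceType) (R : {freeg X / k} -> Prop) c x y z :
  R (<< z >> - (c *: << x >> + << y >>)) ->
  generator R z = c *: generator R x + generator R y.
Proof.
move=> h; rewrite /generator -linearP /=; apply/eqP; rewrite -subr_eq0 -raddfB.
by apply/eqP/quotient_proj_eq0/span_gen.
Qed.

Lemma tensor_word_multilinear : multilinear (@tensor_word k Ho).
Proof. by move=> a b c x y; apply: presented_eq; constructor. Qed.

Lemma wedge_word_multilinear : multilinear (@wedge_word k Hc).
Proof. by move=> a b c x y; apply: presented_eq; do 2!constructor. Qed.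

Lemma wedge_word_symmetric : graded_symmetric (@wedge_word k Hc).
Proof.
move=> d v s h; have := quotient_proj_eq0 (@symmetric_relation k Hc)
  (<< v >> - (-1) ^ koszul s d *: << permute s v >>).
case=> _ /(_ (span_gen (rel_sym s h))).
by rewrite linearB linearZ => /eqP; rewrite subr_eq0 => /eqP.
Qed.

Definition lword (u : seq (letter Hc)) (v : seq (letter Ho)) : C :=
  word (vals u) (vals v).

Lemma letter_symmetric_move (H : gradedSpace k) (W : lmodType k) (g : seq (letter H) -> W)
    x a b : letter_symmetric g ->
  g (x :: a ++ b) = sg (ldeg x * deg a) *: g (a ++ x :: b).
Proof.
elim: a g => [|y a IH] g sym_g /=; first by rewrite deg_nil mulr0 sg0Z.
rewrite (sym_g [::] _ x y) /= (IH (fun w => g (y :: w))) ?sgZZ ?deg_cons ?mulrDr //.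
by move=> a' b'; exact: (sym_g (y :: a') b').
Qed.

(* Reordering letters, with the signs of [koszul], is generated by exchanging
   two neighbours. *)
Lemma symmetric_permseq (H : gradedSpace k) (W : lmodType k) (f : seq (letter H) -> W) n
    (s : 'S_n) w : letter_symmetric f -> size w = n ->
  f w = sg (koszul s (degs w)) *: f (permseq (zero_letter H 0) s w).
Proof.
set z0 := zero_letter H 0.
elim: n w s f => [|n IH] [|x w] s f sf //= => [_|[sz]].
  rewrite /koszul big_ord0 sg0Z; congr (f _); apply/esym/size0nil.
  by rewrite size_permseq.
have [i [t ->]] := lift_permP s; rewrite koszul_lift permseq_lift.
rewrite (IH w t (fun w => f (x :: w))) //; last by move=> a b; exact: (sf (x :: a) b).
rewrite -{1}(cat_take_drop i (permseq z0 t w)) letter_symmetric_move // sgZZ.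
by rewrite addrC /deg /degs map_take permseq_map.
Qed.

Lemma permute_vals (H : gradedSpace k) n (s : 'S_n) (w : seq (letter H)) :
  permute s (vals w) = vals (permseq (zero_letter H 0) s w).
Proof. by rewrite /vals permseq_map. Qed.

Lemma permseq1 T (x0 : T) n w : size w = n -> permseq x0 (1%g : 'S_n) w = w.
Proof.
move=> sz; apply: (@eq_from_nth _ x0) => [|i]; rewrite size_permseq ?sz // => h.
by rewrite (nth_permseq _ _ _ (Ordinal h)) perm1.
Qed.

Lemma koszul1 n d : koszul (1%g : 'S_n) d = 0.
Proof.
rewrite /koszul big1 // => i _; rewrite big1 // => j.
by rewrite !perm1 => /andP[/ltn_trans h /h]; rewrite ltnn.
Qed.

Lemma exchange_perm (H : gradedSpace k) n a (x y : letter H) b :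
  size (a ++ x :: y :: b) = n -> exists s : 'S_n,
  permseq (zero_letter H 0) s (a ++ x :: y :: b) = a ++ y :: x :: b
  /\ koszul s (degs (a ++ x :: y :: b)) = ldeg x * ldeg y.
Proof.
elim: a n => [|z a IH] [|n] //= [sz].
  (* [fintype.lift ord0 ord0] is position 1: the first letter is inserted just behind the second. *)
  case: n sz => [|n] // sz; exists (lift_perm (fintype.lift ord0 ord0) ord0 1%g).
  rewrite permseq_lift koszul_lift !permseq1 //= ?size_map //.
  by rewrite koszul1 addr0 addn0 !take0 drop0 /degsum big_seq1.
have [s [e1 e2]] := IH _ sz; exists (lift_perm ord0 ord0 s).
by rewrite permseq_lift koszul_lift e1 e2 take0 drop0 /= take0 /degsum big_nil mulr0 add0r.
Qed.

Lemma graded_symmetric_letters (H : gradedSpace k) (W : lmodType k) (f : seq H -> W) :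
  graded_symmetric f -> letter_symmetric (fun w => f (vals w)).
Proof.
move=> sf a b x y; set w := a ++ x :: y :: b.
have [|s [e1 e2]] := @exchange_perm H (size (vals w)) a x y b; first by rewrite size_map.
by rewrite (sf _ _ s (letters_homogeneous w)) permute_vals e1 e2.
Qed.

Lemma letters_graded_symmetric (H : gradedSpace k) (W : lmodType k) (f : seq H -> W) :
  letter_symmetric (fun w => f (vals w)) -> graded_symmetric f.
Proof.
move=> sf d v s /homogeneous_letters[w [dw vw]]; case: _ / vw s => s.
by rewrite permute_vals (symmetric_permseq s sf) ?size_map // dw.
Qed.
End Words.

(** * Closure properties of multilinear and symmetric functions of letters *)

Section LetterFunctions.
Variables (k : fieldType) (H : gradedSpace k) (V W : lmodType k).
Implicit Types f g : seq (letter H) -> V.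

Lemma lmultilinear_deg (p : int -> k) f : letter_multilinear f ->
  letter_multilinear (fun w => p (deg w) *: f w).
Proof.
move=> mf a b c x y z E; rewrite (mf _ _ _ _ _ _ E) scalerDr !scalerA.
by case: E => ex ey _; rewrite !degE ex ey mulrC.
Qed.

Lemma lsymmetric_deg (p : int -> k) f : letter_symmetric f ->
  letter_symmetric (fun w => p (deg w) *: f w).
Proof. by move=> sf a b x y; rewrite sf !scalerA mulrC !degE [ldeg x + _]addrCA. Qed.

Lemma lmultilinear_sg (p : int -> int) f : letter_multilinear f ->
  letter_multilinear (fun w => sg (p (deg w)) *: f w).
Proof. exact: (lmultilinear_deg (fun d => sg (p d))). Qed.

Lemma lsymmetric_sg (p : int -> int) f : letter_symmetric f ->
  letter_symmetric (fun w => sg (p (deg w)) *: f w).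
Proof. exact: (lsymmetric_deg (fun d => sg (p d))). Qed.

Lemma lsymmetric_linear (L : {linear V -> W}) f : letter_symmetric f ->
  letter_symmetric (fun w => L (f w)).
Proof. by move=> sf a b x y; rewrite sf linearZ. Qed.

Lemma lmultilinear_tensl (t : W) f : letter_multilinear f -> letter_multilinear (fun w => tens (f w) t).
Proof. by move=> mf a b c x y z E; rewrite (mf _ _ _ _ _ _ E) tens_linl. Qed.

Lemma lmultilinear_tensr (t : W) f : letter_multilinear f -> letter_multilinear (fun w => tens t (f w)).
Proof. by move=> mf a b c x y z E; rewrite (mf _ _ _ _ _ _ E) tens_linr. Qed.

Lemma lsymmetric_tensl (t : W) f : letter_symmetric f -> letter_symmetric (fun w => tens (f w) t).
Proof. by move=> sf a b x y; rewrite sf tensZl. Qed.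

Lemma lsymmetric_tensr (t : W) f : letter_symmetric f -> letter_symmetric (fun w => tens t (f w)).
Proof. by move=> sf a b x y; rewrite sf tensZr. Qed.

Lemma lmultilinear_catl p f : letter_multilinear f -> letter_multilinear (fun w => f (p ++ w)).
Proof. by move=> mf a b c x y z E; rewrite !catA (mf _ _ _ _ _ _ E). Qed.

Lemma lmultilinear_catr p f : letter_multilinear f -> letter_multilinear (fun w => f (w ++ p)).
Proof. by move=> mf a b c x y z E; rewrite -!catA (mf _ _ _ _ _ _ E). Qed.

Lemma lsymmetric_catl p f : letter_symmetric f -> letter_symmetric (fun w => f (p ++ w)).
Proof. by move=> sf a b x y; rewrite !catA sf. Qed.

Lemma lsymmetric_catr p f : letter_symmetric f -> letter_symmetric (fun w => f (w ++ p)).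
Proof. by move=> sf a b x y; rewrite -!catA sf. Qed.

Lemma lmultilinear_size (c : nat -> k) f : letter_multilinear f ->
  letter_multilinear (fun w => c (size w) *: f w).
Proof.
move=> mf a b d x y z E; rewrite (mf _ _ _ _ _ _ E) scalerDr !scalerA !size_cat.
by rewrite mulrC.
Qed.

Lemma lsymmetric_size (c : nat -> k) f : letter_symmetric f ->
  letter_symmetric (fun w => c (size w) *: f w).
Proof. by move=> sf a b x y; rewrite sf !scalerA !size_cat mulrC. Qed.
End LetterFunctions.

Section Coalgebra.
Variables (k : fieldType) (Hc Ho : gradedSpace k).
Local Notation C := (coalg Hc Ho).
Local Notation lword := (@lword k Hc Ho).

Lemma lword_multilinearl v : letter_multilinear (lword^~ v).
Proof.
move=> a b c x y z [_ _ E]; rewrite /lword /word /vals !map_cat /= E.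
by rewrite wedge_word_multilinear tens_linl.
Qed.

Lemma lword_multilinearr u : letter_multilinear (lword u).
Proof.
move=> a b c x y z [_ _ E]; rewrite /lword /word /vals !map_cat /= E.
by rewrite tensor_word_multilinear tens_linr.
Qed.

Lemma lword_symmetricl v : letter_symmetric (lword^~ v).
Proof.
move=> a b x y; rewrite /lword /word.
by rewrite (graded_symmetric_letters (@wedge_word_symmetric k Hc)) tensZl.
Qed.

Lemma word_span (H : gradedSpace k) (W : lmodType k) (f : seq H -> W) v :
  multilinear f -> span (fun y => exists w, size w = size v /\ y = f (vals w)) (f v).
Proof.
move=> mf; suff E a : span (fun y => exists w, size w = (size a + size v)%N /\ y = f (vals w))
    (f (vals a ++ v)) by exact: (E [::]).
elim: v a => [|x v IH] a; first by apply: span_gen; exists a; rewrite cats0 addn0.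
rewrite -(decompE x) multilinear_sum //; apply: span_sum => e _.
have := IH (rcons a e).
by rewrite /vals map_rcons cat_rcons size_rcons addSnnS.
Qed.

Lemma coalg_span (x : C) : span (fun y => exists u v, y = lword u v) x.
Proof.
apply: span_trans (tensor_span (P := fun y => exists u, y = wedge_word (vals u))
  (Q := fun y => exists v, y = tensor_word (vals v)) _ _ x) _.
- move=> y; apply: span_trans (presented_span y) _ => _ [g ->].
  apply: span_trans (word_span g (@wedge_word_multilinear k Hc)) _ => _ [w [_ ->]].
  by apply: span_gen; exists w.
- move=> y; apply: span_trans (presented_span y) _ => _ [g ->].
  apply: span_trans (word_span g (@tensor_word_multilinear k Ho)) _ => _ [w [_ ->]].
  by apply: span_gen; exists w.
by move=> y [_ [_ [[u ->] [v ->] ->]]]; apply: span_gen; exists u, v.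
Qed.

Lemma coalg_eq (W : lmodType k) (f g : {linear C -> W}) :
  (forall u v, f (lword u v) = g (lword u v)) -> f =1 g.
Proof. by move=> E x; apply: span_eq (coalg_span x) => _ [u [v ->]]. Qed.

Lemma fglift_comb (X : choiceType) (W : lmodType k) (f : X -> W) c x y z :
  fglift f (<< z >> - (c *: << x >> + << y >>)) = f z - (c *: f x + f y).
Proof.
have -> : c *: << x >> = << c *g x >> :> {freeg X / k}.
  by apply/eqP/freeg_eqP => h; rewrite coeffZ !coeffU mul1r.
by rewrite raddfB raddfD /= !liftU !scale1r.
Qed.

Lemma fglift_diff (X : choiceType) (W : lmodType k) (f : X -> W) c x y :
  fglift f (<< x >> - c *: << y >>) = f x - c *: f y.
Proof.
have -> : c *: << y >> = << c *g y >> :> {freeg X / k}.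
  by apply/eqP/freeg_eqP => h; rewrite coeffZ !coeffU mul1r.
by rewrite raddfB /= !liftU !scale1r.
Qed.

Lemma tensor_coalg_lift (W : lmodType k) (f : seq (letter Ho) -> W) :
  letter_multilinear f ->
  exists F : {linear tensor_coalg Ho -> W}, forall v, F (tensor_word (vals v)) = f v.
Proof.
move=> mf; have [|F FE] := @presented_lift k _ (@multilinear_relation k Ho) W (multilinear_ext f).
  by move=> _ [c a b x y]; rewrite fglift_comb multilinear_extP // subrr.
by exists F => v; rewrite FE multilinear_ext_vals.
Qed.

Lemma sym_coalg_lift (W : lmodType k) (f : seq (letter Hc) -> W) :
  letter_multilinear f -> letter_symmetric f ->
  exists F : {linear sym_coalg Hc -> W}, forall v, F (wedge_word (vals v)) = f v.
Proof.
move=> mf sf; have [|F FE] := @presented_lift k _ (@symmetric_relation k Hc) W (multilinear_ext f).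
  move=> _ [_ [c a b x y]|d v s h]; first by rewrite fglift_comb multilinear_extP // subrr.
  rewrite fglift_diff (@letters_graded_symmetric _ _ _ _ _ d v s) ?subrr //.
  by move=> a b x y; rewrite !multilinear_ext_vals.
by exists F => v; rewrite FE multilinear_ext_vals.
Qed.

(** One statement serves two kinds of checks in a parameter [x]: multilinearity is the case [d = 1],
    symmetry the case [d = 0]. *)
Lemma span_comb (V W : lmodType k) (P : V -> Prop) (f g h : {linear V -> W}) c d x :
  (forall y, P y -> f y = c *: g y + d *: h y) -> span P x -> f x = c *: g x + d *: h x.
Proof.
move=> E; elim=> [|a y z /E fy _ IH]; first by rewrite !linear0 addr0.
by rewrite !linearP fy IH !scalerDr !scalerA addrACA [a * c]mulrC [a * d]mulrC.
Qed.

(** The map is curried: for each closed word [u] a linear map [G u] on the tensor coalgebra, then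
    for each [t] a linear map on the symmetric coalgebra with values [G u t]. Choice gives no
    linearity in [t]; it is recovered because linear maps agreeing on all [wedge_word] are equal. *)
Lemma coalg_lift (W : lmodType k) (f : seq (letter Hc) -> seq (letter Ho) -> W) :
  (forall v, letter_multilinear (f^~ v)) -> (forall v, letter_symmetric (f^~ v)) ->
  (forall u, letter_multilinear (f u)) ->
  exists F : {linear C -> W}, forall u v, F (lword u v) = f u v.
Proof.
move=> mc sc mo.
have [G GE] := choice (fun u => tensor_coalg_lift (mo u)).
pose P (t : tensor_coalg Ho) := exists v, t = tensor_word (vals v).
have sp t : span P t.
  apply: span_trans (presented_span t) _ => _ [g ->].
  apply: span_trans (word_span g (@tensor_word_multilinear k Ho)) _ => _ [w [_ ->]].
  by apply: span_gen; exists w.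
have ex t : exists F : {linear sym_coalg Hc -> W}, forall u, F (wedge_word (vals u)) = G u t.
  apply: sym_coalg_lift => [a b c x y z E|a b x y].
    rewrite -[G (a ++ y :: b) t]scale1r; apply: span_comb (sp t) => _ [v ->].
    by rewrite !GE scale1r; exact: mc E.
  rewrite -[RHS]addr0 -[X in _ + X](scale0r (G (a ++ y :: x :: b) t)).
  apply: span_comb (sp t) => _ [v ->].
  by rewrite !GE scale0r addr0; exact: sc.
have [F FE] := choice ex.
have [|m c t t'|L LE] := @tensor_lift k (sym_coalg Hc) (tensor_coalg Ho) W (fun m t => F t m).
- by move=> t; exact: linearP.
- rewrite -[F t' m]scale1r.
  have sm : span (fun y => exists u, y = wedge_word (vals u)) m.
    apply: span_trans (presented_span m) _ => _ [g ->].
    apply: span_trans (word_span g (@wedge_word_multilinear k Hc)) _ => _ [w [_ ->]].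
    by apply: span_gen; exists w.
  by apply: span_comb sm => _ [u ->]; rewrite !FE linearP scale1r.
by exists L => u v; rewrite LE FE GE.
Qed.

Lemma coalg2_lift (W : lmodType k)
    (f : seq (letter Hc) -> seq (letter Ho) -> seq (letter Hc) -> seq (letter Ho) -> W) :
  (forall x b y, letter_multilinear (fun a => f a x b y)) ->
  (forall x b y, letter_symmetric (fun a => f a x b y)) ->
  (forall a b y, letter_multilinear (fun x => f a x b y)) ->
  (forall a x y, letter_multilinear (fun b => f a x b y)) ->
  (forall a x y, letter_symmetric (fun b => f a x b y)) ->
  (forall a x b, letter_multilinear (fun y => f a x b y)) ->
  exists F : {linear tensor C C -> W},
    forall a x b y, F (tens (lword a x) (lword b y)) = f a x b y.
Proof.
move=> ma sa mx mb sb my.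
have [G GE] := choice (fun p : seq (letter Hc) * seq (letter Ho) =>
  coalg_lift (fun x => mb p.1 p.2 x) (fun x => sb p.1 p.2 x) (fun a => my p.1 p.2 a)).
have ex t : exists F : {linear C -> W}, forall a x, F (lword a x) = G (a, x) t.
  have [|||F FE] := @coalg_lift W (fun a x => G (a, x) t).
  - move=> v a b c x y z E; rewrite -[G (a ++ y :: b, v) t]scale1r.
    apply: span_comb (coalg_span t) => _ [u' [v' ->]].
    by rewrite !GE scale1r /=; exact: (ma v u' v' a b c x y z E).
  - move=> v a b x y; rewrite -[RHS]addr0 -[X in _ + X](scale0r (G (a ++ y :: x :: b, v) t)).
    apply: span_comb (coalg_span t) => _ [u' [v' ->]].
    by rewrite !GE scale0r addr0; exact: (sa v u' v' a b x y).
  - move=> u a b c x y z E; rewrite -[G (u, a ++ y :: b) t]scale1r.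
    apply: span_comb (coalg_span t) => _ [u' [v' ->]].
    by rewrite !GE scale1r /=; exact: (mx u u' v' a b c x y z E).
  by exists F.
have [F FE] := choice ex.
have [|m c t t'|L LE] := @tensor_lift k C C W (fun m t => F t m).
- by move=> t; exact: linearP.
- rewrite -[F t' m]scale1r; apply: span_comb (coalg_span m) => _ [u [v ->]].
  by rewrite !FE linearP scale1r.
by exists L => a x b y; rewrite LE FE GE.
Qed.
End Coalgebra.

(** * Comparison of the recursive sums with the indexed sums of the definitions *)

Section Bridges.
Variables (k : fieldType) (V : lmodType k).

Lemma permute_degs (H : gradedSpace k) n (s : 'S_n) (w : seq (letter H)) :
  permute s (degs w) = degs (permseq (zero_letter H 0) s w).
Proof. by rewrite /degs permseq_map. Qed.

(** The definitions keep vectors and degrees in separate lists, so [G] receives them separately. *)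
Lemma usum_permute (H : gradedSpace k) (w : seq (letter H))
    (G : seq int -> seq H -> seq int -> seq H -> V) :
  usum w (fun a b => G (degs a) (vals a) (degs b) (vals b))
  = \sum_(p < (size (vals w)).+1) \sum_(s : 'S_(size (vals w)) | unshuffle p s)
      (-1) ^ koszul s (degs w) *:
      G (take p (permute s (degs w))) (take p (permute s (vals w)))
        (drop p (permute s (degs w))) (drop p (permute s (vals w))).
Proof.
rewrite -(@usum_unshuffle _ _ _ (size (vals w))) ?size_map //.
apply: eq_bigr => p _; apply: eq_bigr => s _.
by rewrite permute_vals permute_degs /vals /degs !map_take !map_drop.
Qed.

(** Two cuts amount to the position [j] and the length [q] of the middle piece. Cutting sums over
    [j] first, the definitions over [q] first; the triangle [j + q <= N] is traversed in both
    orders. *)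
Lemma csum2_take_drop (T : Type) (v : seq T) (F : seq T -> seq T -> seq T -> V) :
  csum v (fun x yz => csum yz (F x))
  = \sum_(q < (size v).+1) \sum_(j < (size v - q).+1)
      F (take j v) (take q (drop j v)) (drop (j + q) v).
Proof.
set N := size v.
transitivity (\sum_(j < N.+1) \sum_(q < N.+1 | (j + q <= N)%N)
    F (take j v) (take q (drop j v)) (drop (j + q) v)).
  rewrite csum_take_drop; apply: eq_bigr => j _.
  rewrite csum_take_drop size_drop -/N.
  rewrite (big_ord_widen N.+1 (fun q => F _ (take q _) (drop q _))) ?ltnS ?leq_subr //.
  apply: eq_big => [q|q _]; last by rewrite drop_drop addnC.
  by rewrite ltnS leq_subRL // -ltnS.
rewrite (exchange_big_dep xpredT) //=; apply: eq_bigr => q _.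
rewrite (big_ord_widen N.+1 (fun j => F (take j v) (take q (drop j v)) (drop (j + q) v))) ?ltnS ?leq_subr //.
by apply: eq_bigl => j; move: (ltn_ord q) (ltn_ord j); lia.
Qed.

Lemma csum_exchange (T : Type) (x y : seq T) (F : seq T -> seq T -> seq T -> seq T -> V) :
  csum x (fun a b => csum y (F a b)) = csum y (fun c d => csum x (fun a b => F a b c d)).
Proof.
elim: x F => [|z x IH] F //=.
by rewrite csumD IH.
Qed.

Lemma usum_lin (H : gradedSpace k) (W : lmodType k) (f : V -> W) (w : seq (letter H)) F :
  linear f -> f (usum w F) = usum w (fun a b => f (F a b)).
Proof.
by move=> /linear_pack[L LE]; rewrite -LE usum_linear; apply: eq_usum => a b _ _; rewrite LE.
Qed.

Lemma csum_lin (T : Type) (W : lmodType k) (f : V -> W) (v : seq T) F :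
  linear f -> f (csum v F) = csum v (fun a b => f (F a b)).
Proof.
by move=> /linear_pack[L LE]; rewrite -LE csum_linear; apply: eq_csum => a b _; rewrite LE.
Qed.

Lemma span_usum (H : gradedSpace k) (P : V -> Prop) (w : seq (letter H)) F :
  (forall a b, deg a + deg b = deg w -> span P (F a b)) -> span P (usum w F).
Proof.
elim: w F => [|x w IH] F E /=; first by apply: E; rewrite deg_nil addr0.
apply: IH => a b ab; apply: spanD; last apply: spanZ; apply: E.
  by rewrite !deg_cons -ab addrA.
by rewrite !deg_cons -ab addrCA.
Qed.

Lemma span_csum (T : Type) (P : V -> Prop) (v : seq T) F :
  (forall a b, a ++ b = v -> span P (F a b)) -> span P (csum v F).
Proof.
move=> E; rewrite csum_take_drop; apply: span_sum => q _; apply: E; exact: cat_take_drop.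
Qed.
End Bridges.

Section ParametricSums.
Variables (k : fieldType) (H : gradedSpace k) (V : lmodType k) (T : Type).

Lemma lmultilinear_csum (v : seq T) (F : seq (letter H) -> seq T -> seq T -> V) :
  (forall x y, letter_multilinear (fun w => F w x y)) ->
  letter_multilinear (fun w => csum v (F w)).
Proof.
move=> mF a b c x y z E; rewrite -csum_comb; apply: eq_csum => e f _.
exact: (mF e f a b c x y z E).
Qed.

Lemma lsymmetric_csum (v : seq T) (F : seq (letter H) -> seq T -> seq T -> V) :
  (forall x y, letter_symmetric (fun w => F w x y)) ->
  letter_symmetric (fun w => csum v (F w)).
Proof.
move=> sF a b x y; rewrite -csumZ; apply: eq_csum => e f _.
exact: (sF e f a b x y).
Qed.

Lemma lmultilinear_usum (H' : gradedSpace k) (u : seq (letter H'))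
    (F : seq (letter H) -> seq (letter H') -> seq (letter H') -> V) :
  (forall x y, letter_multilinear (fun w => F w x y)) ->
  letter_multilinear (fun w => usum u (F w)).
Proof.
move=> mF a b c x y z E; rewrite -usum_comb; apply: eq_usum => e f _ _.
exact: (mF e f a b c x y z E).
Qed.
End ParametricSums.

(** * Coproduct, counit, projections onto letters and diagonal maps *)

Section Coproduct.
Variables (k : fieldType) (Hc Ho : gradedSpace k).
Local Notation C := (coalg Hc Ho).
Local Notation lword := (@lword k Hc Ho).

(** Used in two ways: with inverted eigenvalues in [primitive_eq0], and with the indicator of
    [n = 0], which gives the projection onto Lambda Hc. *)
Lemma size_scaling_ex (c : nat -> nat -> k) : exists F : {linear C -> C},
  forall u v, F (lword u v) = c (size u) (size v) *: lword u v.
Proof.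
apply: coalg_lift => [v|v|u].
- by apply: (@lmultilinear_size _ _ _ (c^~ (size v))); exact: lword_multilinearl.
- by apply: (@lsymmetric_size _ _ _ (c^~ (size v))); exact: lword_symmetricl.
- by apply: (@lmultilinear_size _ _ _ (c (size u))); exact: lword_multilinearr.
Qed.

Lemma closed_letter_proj : exists F : {linear C -> Hc},
  forall u v, F (lword u v) = if v is [::] then if u is [:: x] then lval x else 0 else 0.
Proof.
apply: coalg_lift => [[|y v]|[|y v]|u].
- by move=> [|e [|e1 a]] [|f b] c x y z [_ _ E] /=; rewrite ?scaler0 ?addr0.
- by move=> a b c x y' z _; rewrite scaler0 addr0.
- by move=> [|e [|e1 a]] b x y /=; rewrite ?scaler0.
- by move=> a b x y'; rewrite scaler0.
- by move=> [|e a] b c x y z _; rewrite scaler0 addr0.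
Qed.

Lemma open_letter_proj : exists F : {linear C -> Ho},
  forall u v, F (lword u v) = if u is [::] then if v is [:: x] then lval x else 0 else 0.
Proof.
apply: coalg_lift => [v|v|[|e' u]].
- by move=> [|e a] b c x y z _; rewrite scaler0 addr0.
- by move=> [|e a] b x y; rewrite scaler0.
- by move=> [|e [|e1 a]] [|f b] c x y z [_ _ E] /=; rewrite ?scaler0 ?addr0.
- by move=> a b c x y z _; rewrite scaler0 addr0.
Qed.

Lemma counit_ex : exists eps : {linear C -> k^o},
  forall u v, eps (lword u v) = (nilp u && nilp v)%:R.
Proof.
apply: coalg_lift => [v|v|u].
- by move=> [|e a] b c x y z _; rewrite scaler0 addr0.
- by move=> [|e a] b x y; rewrite scaler0.
- by move=> [|e a] b c x y z _; rewrite /= andbF scaler0 addr0.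
Qed.

(** With [sg] this is the sign operator of the Koszul rule; with indicators of parity it splits the
    coalgebra into even and odd parts. *)
Lemma degree_scaling_ex (c : int -> k) : exists F : {linear C -> C},
  forall u v, F (lword u v) = c (deg u + deg v) *: lword u v.
Proof.
apply: coalg_lift => [v|v|u].
- apply: (lmultilinear_deg (fun d => c (d + deg v))); exact: lword_multilinearl.
- apply: (lsymmetric_deg (fun d => c (d + deg v))); exact: lword_symmetricl.
- apply: (lmultilinear_deg (fun d => c (deg u + d))); exact: lword_multilinearr.
Qed.

Lemma lword_deg u v : coalg_deg (deg u + deg v) (lword u v).
Proof.
apply: span_gen; exists (degs u), (vals u), (degs v), (vals v).
by split=> //; exact: letters_homogeneous.
Qed.

Lemma degree_scalingE (c : int -> k) (F : {linear C -> C}) e x :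
  (forall u v, F (lword u v) = c (deg u + deg v) *: lword u v) ->
  coalg_deg e x -> F x = c e *: x.
Proof.
move=> FE; elim=> [|a _ z [du [u [dv [v [hu hv de ->]]]]] _ IH]; first by rewrite linear0 scaler0.
have [[w [wd wv]] [t [td tv]]] := (homogeneous_letters hu, homogeneous_letters hv).
by rewrite linearP IH -wv -tv FE -de /deg wd td scalerDr !scalerA mulrC.
Qed.

Definition is_lcoproduct (Delta : {linear C -> tensor C C}) :=
  forall u v, Delta (lword u v) = usum u (fun a b => csum v (fun x y =>
    sg (deg b * deg x) *: tens (lword a x) (lword b y))).

Lemma coproduct_ex : exists Delta : {linear C -> tensor C C}, is_lcoproduct Delta.
Proof.
apply: coalg_lift => [v|v|u].
- apply: usum_multilinear => [b|a]; apply: lmultilinear_csum => x y.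
    by apply: (lmultilinear_sg (fun _ => deg b * deg x)); apply: lmultilinear_tensl; exact: lword_multilinearl.
  by apply: (lmultilinear_sg (fun d => d * deg x)); apply: lmultilinear_tensr; exact: lword_multilinearl.
- apply: usum_symmetric => [b|a]; apply: lsymmetric_csum => x y.
    by apply: (lsymmetric_sg (fun _ => deg b * deg x)); apply: lsymmetric_tensl; exact: lword_symmetricl.
  by apply: (lsymmetric_sg (fun d => d * deg x)); apply: lsymmetric_tensr; exact: lword_symmetricl.
- apply: lmultilinear_usum => a b; apply: csum_multilinear => [y|x].
    by apply: (lmultilinear_sg (fun d => deg b * d)); apply: lmultilinear_tensl; exact: lword_multilinearr.
  by apply: (lmultilinear_sg (fun _ => deg b * deg x)); apply: lmultilinear_tensr; exact: lword_multilinearr.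
Qed.

Lemma lcoproductP Delta : is_lcoproduct Delta -> is_coproduct Delta.
Proof.
move=> DE du u dv v /homogeneous_letters[w [<- <-]] /homogeneous_letters[t [<- <-]].
rewrite -[word _ _]/(lword w t) DE usum_csum csum_take_drop exchange_big /= size_map.
apply: eq_bigr => q _.
pose G (da : seq int) (va : seq Hc) db vb : tensor C C :=
  sg (degsum db * degsum (take q (degs t)))
  *: tens (word va (take q (vals t))) (word vb (drop q (vals t))).
transitivity (usum w (fun a b => G (degs a) (vals a) (degs b) (vals b))).
  apply: eq_usum => a b _ _; rewrite /G /lword.
  by rewrite /deg /degs /vals !map_take !map_drop.
rewrite usum_permute; apply: eq_bigr => p _; apply: eq_bigr => s _.
by rewrite /G scalerA -sgD.
Qed.
End Coproduct.

(** * Lifts are coderivations *)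

Section LetterValued.
Variables (k : fieldType) (H K : gradedSpace k) (W : lmodType k).
Variables (h : seq (letter H) -> letter K) (e : int).
Hypothesis h_deg : forall a, ldeg (h a) = deg a + e.

Lemma lmultilinear_letter (f : seq (letter K) -> W) p q :
  letter_multilinear (fun a => lval (h a)) -> letter_multilinear f ->
  letter_multilinear (fun a => f (p ++ h a :: q)).
Proof.
move=> mh mf a b c x y z E; apply: mf; split; rewrite ?(mh _ _ _ _ _ _ E) //.
  by case: E => ex _ _; rewrite !h_deg !degE ex.
by case: E => _ ey _; rewrite !h_deg !degE ey.
Qed.

Lemma lsymmetric_letter (f : seq (letter K) -> W) p q :
  letter_symmetric (fun a => lval (h a)) -> letter_multilinear f ->
  letter_symmetric (fun a => f (p ++ h a :: q)).
Proof.
move=> sh mf a b x y; set z := h _; set z' := h _.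
have zz : ldeg z' = ldeg z by rewrite !h_deg !degE [ldeg y + _]addrCA.
(* A multiple of a letter is a combination whose second term is a zero letter of the same degree. *)
have comb : letter_comb (sg (ldeg x * ldeg y)) z' (zero_letter K (ldeg z)) z.
  by split=> //=; rewrite addr0; exact: sh.
have := mf p q _ _ _ _ comb.
by rewrite (letter_linear0 (z := zero_letter K (ldeg z)) (mf p q)) // addr0.
Qed.
End LetterValued.

Section Lift.
Variables (k : fieldType) (Hc Ho : gradedSpace k).
Local Notation C := (coalg Hc Ho).
Local Notation lword := (@lword k Hc Ho).
Variables (l : seq Hc -> Hc) (n : seq Hc -> seq Ho -> Ho).
Hypotheses (Hl : closed_ops l) (Hn : open_ops n).

Lemma cletter_subproof a : gdeg (deg a + 1) (l (vals a)).
Proof. by case: Hl => _ _ _; apply; exact: letters_homogeneous. Qed.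
(** The output carries the degree prescribed by the operation even if its value is zero, so it can
    enter later signs as any other letter. *)
Definition cletter a : letter Hc := Letter (cletter_subproof a).

Lemma oletter_subproof b y : gdeg (deg b + deg y + 1) (n (vals b) (vals y)).
Proof. by case: Hn => _ _ _; apply; exact: letters_homogeneous. Qed.
Definition oletter b y : letter Ho := Letter (oletter_subproof b y).

(** The empty block [a] is included and contributes zero because [l [::] = 0]; this agrees with the
    sum from [p = 1] in [is_lift]. *)
Definition closed_lift_word u v : C := usum u (fun a b => lword (cletter a :: b) v).

Definition open_lift_word u v : C :=
  usum u (fun a b => csum v (fun x yz => csum yz (fun y z =>
    sg (deg a + deg x + deg x * deg b) *: lword a (x ++ oletter b y :: z)))).

Definition is_lift_word (D : {linear C -> C}) :=
  forall u v, D (lword u v) = closed_lift_word u v + open_lift_word u v.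

Lemma lift_word_ex : exists Dc Do : {linear C -> C},
  (forall u v, Dc (lword u v) = closed_lift_word u v)
  /\ (forall u v, Do (lword u v) = open_lift_word u v).
Proof.
have lml_l : letter_multilinear (fun a => l (vals a)).
  by case: Hl => _ ml _ _; exact: multilinear_letters.
have lsym_l : letter_symmetric (fun a => l (vals a)).
  by case: Hl => _ _ sl _; exact: graded_symmetric_letters.
have lml_n1 y : letter_multilinear (fun b => n (vals b) (vals y)).
  by case: Hn => _ /(_ (vals y))[mn _] _ _; exact: (multilinear_letters mn).
have lsym_n1 y : letter_symmetric (fun b => n (vals b) (vals y)).
  by case: Hn => _ /(_ (vals y))[_ sn] _ _; exact: (graded_symmetric_letters sn).
have lml_n2 b : letter_multilinear (fun y => n (vals b) (vals y)).
  by case: Hn => _ _ mn _; exact: (multilinear_letters (mn (vals b))).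
have [||| Dc DcE] := @coalg_lift k Hc Ho C closed_lift_word.
- move=> v; apply: usum_multilinear => [b|a].
    exact: (@lmultilinear_letter _ _ _ _ cletter 1 _ (lword^~ v) [::] b lml_l (@lword_multilinearl _ _ _ v)).
  exact: (lmultilinear_catl [:: cletter a] (@lword_multilinearl _ _ _ v)).
- move=> v; apply: usum_symmetric => [b|a].
    exact: (@lsymmetric_letter _ _ _ _ cletter 1 _ (lword^~ v) [::] b lsym_l (@lword_multilinearl _ _ _ v)).
  exact: (lsymmetric_catl [:: cletter a] (@lword_symmetricl _ _ _ v)).
- by move=> u; apply: lmultilinear_usum => a b; exact: lword_multilinearr.
have [||| Do DoE] := @coalg_lift k Hc Ho C open_lift_word.
- move=> v; apply: usum_multilinear => [b|a]; apply: lmultilinear_csum => x yz; apply: lmultilinear_csum => y z.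
    apply: (lmultilinear_sg (fun d => d + deg x + deg x * deg b)); exact: lword_multilinearl.
  apply: (lmultilinear_sg (fun d => deg a + deg x + deg x * d)).
  apply: (@lmultilinear_letter _ _ _ _ (oletter^~ y) (deg y + 1) _ (lword a)) => //.
  - by move=> b; rewrite /= addrA.
  - exact: lml_n1.
  - exact: lword_multilinearr.
- move=> v; apply: usum_symmetric => [b|a]; apply: lsymmetric_csum => x yz; apply: lsymmetric_csum => y z.
    apply: (lsymmetric_sg (fun d => d + deg x + deg x * deg b)); exact: lword_symmetricl.
  apply: (lsymmetric_sg (fun d => deg a + deg x + deg x * d)).
  apply: (@lsymmetric_letter _ _ _ _ (oletter^~ y) (deg y + 1) _ (lword a)) => //.
  - by move=> b; rewrite /= addrA.
  - exact: lsym_n1.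
  - exact: lword_multilinearr.
- move=> u; apply: lmultilinear_usum => a b; apply: csum_multilinear => [yz|x].
    apply: lmultilinear_csum => y z.
    apply: (lmultilinear_sg (fun d => deg a + d + d * deg b)).
    exact: (lmultilinear_catr (oletter b y :: z) (@lword_multilinearr _ _ _ a)).
  apply: csum_multilinear => [z|y].
    apply: (lmultilinear_sg (fun _ => deg a + deg x + deg x * deg b)).
    apply: (@lmultilinear_letter _ _ _ _ (oletter b) (deg b + 1) _ (lword a)) => //.
    - by move=> y; rewrite /= -addrA addrCA.
    - exact: lml_n2.
    - exact: lword_multilinearr.
  apply: (lmultilinear_sg (fun _ => deg a + deg x + deg x * deg b)).
  rewrite (_ : (fun w => _) = (fun w => lword a ((x ++ [:: oletter b y]) ++ w))).
    exact: (lmultilinear_catl _ (@lword_multilinearr _ _ _ a)).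
  by apply/funext => w; rewrite -catA.
by exists Dc, Do.
Qed.

Lemma lift_word_deg u v (D : {linear C -> C}) : is_lift_word D ->
  coalg_deg (deg u + deg v + 1) (D (lword u v)).
Proof.
move=> ->; apply: spanD.
  apply: span_usum => a b ab; rewrite -ab.
  have := lword_deg (cletter a :: b) v; rewrite deg_cons /=.
  by congr (coalg_deg _ _); rewrite -!addrA; congr (_ + _); rewrite addrC -addrA.
apply: span_usum => a b ab; apply: span_csum => x yz xyz; apply: span_csum => y z yzE.
apply: spanZ; rewrite -ab -xyz -yzE.
have := lword_deg a (x ++ oletter b y :: z); rewrite !degE /=.
congr (coalg_deg _ _); lia.
Qed.
End Lift.

Section Coderivations.
Variables (k : fieldType) (Hc Ho : gradedSpace k).
Local Notation C := (coalg Hc Ho).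
Local Notation lword := (@lword k Hc Ho).
Variable Delta : {linear C -> tensor C C}.
Hypothesis DeltaE : is_lcoproduct Delta.

(** The coderivation identity for a map of degree [e], written on words; [e] is 1 for D and 0 for
    its square. Since [E] is a bare function, composites and combinations need no packing. *)
Definition coder_word (e : int) (E : C -> C) := forall u v,
  Delta (E (lword u v)) = usum u (fun a b => csum v (fun x y =>
    sg (deg b * deg x) *: (tens (E (lword a x)) (lword b y)
      + sg (e * (deg a + deg x)) *: tens (lword a x) (E (lword b y))))).

Lemma tensl_linear (M N : lmodType k) (y : N) : linear (fun x : M => tens x y).
Proof. by move=> c x x'; rewrite tens_linl. Qed.

Lemma tensr_linear (M N : lmodType k) (x : M) : linear (fun y : N => tens x y).
Proof. by move=> c y y'; rewrite tens_linr. Qed.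

Lemma coder_word_comb e c (D E F : C -> C) : (forall x, F x = c *: D x + E x) ->
  coder_word e D -> coder_word e E -> coder_word e F.
Proof.
move=> FE cD cE u v; rewrite FE linearP cD cE -usum_comb; apply: eq_usum => a b _ _.
rewrite -csum_comb; apply: eq_csum => x y _.
rewrite scalerA mulrC -scalerA -scalerDr; congr (_ *: _).
by rewrite !FE tens_linl tens_linr !scalerDr !scalerA [_ * c]mulrC addrACA.
Qed.

Section Lift.
Variables (l : seq Hc -> Hc) (n : seq Hc -> seq Ho -> Ho).
Hypotheses (Hl : closed_ops l) (Hn : open_ops n).

(** The terms split according to the block that receives the output of [l]. If it is the left one,
    they regroup by [usum_assoc]. If it is the right one, [usum_rotate] first moves the inputs of
    [l] behind the left block, and the degree one of [l] leaves the sign of passing that block. *)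
Lemma closed_lift_coder (D : {linear C -> C}) :
  (forall u v, D (lword u v) = closed_lift_word Hl u v) -> coder_word 1 D.
Proof.
move=> DE u v; rewrite DE /closed_lift_word usum_linear.
pose T a1 x a2 y : tensor C C := tens (lword a1 x) (lword a2 y).
transitivity
  (usum u (fun a b => usum b (fun b1 b2 => csum v (fun x y =>
     sg (deg b2 * deg x) *: T (cletter Hl a :: b1) x b2 y)))
  + usum u (fun a b => usum b (fun b1 b2 => csum v (fun x y =>
     sg ((deg a + 1) * deg b1 + (deg a + 1 + deg b2) * deg x) *: T b1 x (cletter Hl a :: b2) y)))).
  rewrite -usumD; apply: eq_usum => a b _ _; rewrite DeltaE /= -usumD.
  apply: eq_usum => b1 b2 _ _; congr (_ + _); rewrite -csumZ; apply: eq_csum => x y _.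
  by rewrite sgZZ deg_cons.
rewrite [in X in _ + X]usum_rotate.
transitivity
  (usum u (fun a b => csum v (fun x y => sg (deg b * deg x) *: tens (D (lword a x)) (lword b y)))
  + usum u (fun a b => csum v (fun x y =>
      sg (deg b * deg x + (deg a + deg x)) *: tens (lword a x) (D (lword b y))))); last first.
  rewrite -usumD; apply: eq_usum => a b _ _; rewrite -csumD; apply: eq_csum => x y _.
  by rewrite scalerDr sgZZ mul1r.
congr (_ + _).
  rewrite -usum_assoc; apply: eq_usum => a b _ _; rewrite usum_csum; apply: eq_csum => x y _.
  by rewrite usumZ DE (usum_lin _ _ (tensl_linear _)).
apply: eq_usum => a b _ _.
transitivity (usum b (fun b1 b2 => csum v (fun x y =>
   sg (deg b * deg x + (deg a + deg x)) *: T a x (cletter Hl b1 :: b2) y))).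
  apply: eq_usum => b1 b2 <- _; rewrite -csumZ; apply: eq_csum => x y _.
  by rewrite sgZZ; signs.
rewrite usum_csum; apply: eq_csum => x y _.
by rewrite usumZ DE (usum_lin _ _ (tensr_linear _)).
Qed.

(** The closed letters fall into three blocks: the inputs [b] and the two parts [a1], [a2] of the
    rest. A cut of the open letters passes to the right or to the left of the output. In the first
    case [b] must join [a1], hence an exchange of [a2] and [b]; in the second it already stands next
    to [a2]. *)
Lemma open_lift_coder (D : {linear C -> C}) :
  (forall u v, D (lword u v) = open_lift_word Hn u v) -> coder_word 1 D.
Proof.
move=> DE u v; rewrite DE /open_lift_word usum_linear.
pose T a1 x a2 y : tensor C C := tens (lword a1 x) (lword a2 y).
pose N := oletter Hn.
transitivity
  (usum u (fun a b => usum a (fun a1 a2 => csum v (fun x yz => csum yz (fun y z =>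
     csum z (fun z1 z2 =>
     sg (deg a1 + deg a2 + deg x + deg x * deg b + deg a2 * (deg x + (deg b + deg y + 1) + deg z1))
     *: T a1 (x ++ N b y :: z1) a2 z2)))))
  + usum u (fun a b => usum a (fun a1 a2 => csum v (fun x yz => csum x (fun x1 x2 =>
     csum yz (fun y z =>
     sg (deg a1 + deg a2 + (deg x1 + deg x2) + (deg x1 + deg x2) * deg b + deg a2 * deg x1)
     *: T a1 x1 a2 (x2 ++ N b y :: z))))))).
  rewrite -usumD; apply: eq_usum => a b _ _; rewrite csum_linear -usumD.
  transitivity (csum v (fun x yz => usum a (fun a1 a2 => csum yz (fun y z =>
     csum z (fun z1 z2 =>
     sg (deg a + deg x + deg x * deg b + deg a2 * (deg x + (deg b + deg y + 1) + deg z1))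
     *: T a1 (x ++ N b y :: z1) a2 z2)) +
     csum x (fun x1 x2 => csum yz (fun y z =>
     sg (deg a + deg x + deg x * deg b + deg a2 * deg x1)
     *: T a1 x1 a2 (x2 ++ N b y :: z)))))).
    apply: eq_csum => x yz _; rewrite csum_linear.
    transitivity (csum yz (fun y z => usum a (fun a1 a2 =>
     csum z (fun z1 z2 =>
     sg (deg a + deg x + deg x * deg b + deg a2 * (deg x + (deg b + deg y + 1) + deg z1))
     *: T a1 (x ++ N b y :: z1) a2 z2) +
     csum x (fun x1 x2 =>
     sg (deg a + deg x + deg x * deg b + deg a2 * deg x1)
     *: T a1 x1 a2 (x2 ++ N b y :: z))))).
      apply: eq_csum => y z _.
      rewrite linearZ /= DeltaE -usumZ; apply: eq_usum => a1 a2 _ _.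
      rewrite csum_cat scalerDr addrC -!csumZ; congr (_ + _); apply: eq_csum => x1 x2 _.
        by rewrite sgZZ !degE addrA.
      by rewrite sgZZ.
    rewrite -usum_csum; apply: eq_usum => a1 a2 _ _.
    by rewrite csumD; congr (_ + _); exact: csum_exchange.
  rewrite -usum_csum; apply: eq_usum => a1 a2 <- _; rewrite csumD; congr (_ + _).
  apply: eq_csum => x yz _; apply: eq_csum => x1 x2 <-; apply: eq_csum => y z _.
  by rewrite deg_cat.
transitivity
  (usum u (fun a b => csum v (fun x y => sg (deg b * deg x) *: tens (D (lword a x)) (lword b y)))
  + usum u (fun a b => csum v (fun x y =>
      sg (deg b * deg x + (deg a + deg x)) *: tens (lword a x) (D (lword b y))))); last first.
  rewrite -usumD; apply: eq_usum => a b _ _; rewrite -csumD; apply: eq_csum => x y _.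
  by rewrite scalerDr sgZZ mul1r.
congr (_ + _).
  rewrite usum_assoc.
  transitivity (usum u (fun a1 b' => usum b' (fun a2 b => csum v (fun p t => csum t (fun q s =>
      csum s (fun r w => sg (deg b * (deg p + deg q + deg r) + (deg a1 + deg p + deg p * deg a2))
        *: T a1 (p ++ N a2 q :: r) b w)))))).
    apply: eq_usum => a1 b' _ _; rewrite usum_swap; apply: eq_usum => a2 b _ _.
    rewrite -csumZ; apply: eq_csum => x yz _; rewrite -csumZ; apply: eq_csum => y z _.
    by rewrite -csumZ; apply: eq_csum => z1 z2 _; rewrite sgZZ; signs.
  rewrite -usum_assoc; apply: eq_usum => a b _ _.
  transitivity (usum a (fun a1 a2 => csum v (fun x w => csum x (fun p qr => csum qr (fun q r =>
      sg (deg b * (deg p + deg q + deg r) + (deg a1 + deg p + deg p * deg a2))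
        *: T a1 (p ++ N a2 q :: r) b w))))).
    apply: eq_usum => a1 a2 _ _; rewrite csum_assoc; apply: eq_csum => p t _.
    by rewrite csum_assoc.
  rewrite usum_csum; apply: eq_csum => x w _.
  rewrite DE /open_lift_word (usum_lin _ _ (tensl_linear _)) -usumZ; apply: eq_usum => a1 a2 _ _.
  rewrite (csum_lin _ _ (tensl_linear _)) -csumZ; apply: eq_csum => p qr pqr.
  rewrite (csum_lin _ _ (tensl_linear _)) -csumZ; apply: eq_csum => q r qrE.
  by rewrite tensZl sgZZ -pqr -qrE !deg_cat; signs.
rewrite usum_assoc; apply: eq_usum => a b _ _.
transitivity (usum b (fun b1 b2 => csum v (fun x t => csum t (fun p qr => csum qr (fun q r =>
  sg (deg b * deg x + (deg a + deg x) + (deg b1 + deg p + deg p * deg b2))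
    *: T a x b1 (p ++ N b2 q :: r)))))).
  apply: eq_usum => b1 b2 <- _; rewrite csum_assoc.
  apply: eq_csum => x t _; apply: eq_csum => p qr _; apply: eq_csum => q r _; signs.
rewrite usum_csum; apply: eq_csum => x t _.
rewrite DE /open_lift_word (usum_lin _ _ (tensr_linear _)) -usumZ; apply: eq_usum => b1 b2 _ _.
rewrite (csum_lin _ _ (tensr_linear _)) -csumZ; apply: eq_csum => p qr _.
rewrite (csum_lin _ _ (tensr_linear _)) -csumZ; apply: eq_csum => q r _.
by rewrite tensZr sgZZ.
Qed.
End Lift.
End Coderivations.

(** * Coderivations are determined by their corestrictions *)

Section LinearExtensionality.
Variables (k : fieldType) (Hc Ho : gradedSpace k) (W : lmodType k).

Lemma coalg_ext (f g : coalg Hc Ho -> W) : linear f -> linear g ->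
  (forall u v, f (lword u v) = g (lword u v)) -> f =1 g.
Proof.
move=> /linear_pack[F FE] /linear_pack[G GE] E x.
by rewrite -FE -GE; apply: coalg_eq => u v; rewrite FE GE.
Qed.
End LinearExtensionality.

Lemma multilinear0 (k : fieldType) (V W : lmodType k) (f : seq V -> W) a b :
  multilinear f -> f (a ++ 0 :: b) = 0.
Proof.
move=> mf; apply: (addrI (f (a ++ 0 :: b))).
by rewrite addr0 -[X in X + _]scale1r -mf scale1r addr0.
Qed.

Section Word.
Variables (k : fieldType) (Hc Ho : gradedSpace k).

Lemma word_multilinearl (v : seq Ho) : multilinear (fun u : seq Hc => word u v).
Proof. by move=> a b c x y; rewrite /word wedge_word_multilinear tens_linl. Qed.

Lemma word_multilinearr (u : seq Hc) : multilinear (fun v : seq Ho => word u v).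
Proof. by move=> a b c x y; rewrite /word tensor_word_multilinear tens_linr. Qed.
End Word.

Section Vanishing.
Variables (k : fieldType) (Hc Ho : gradedSpace k).
Local Notation C := (coalg Hc Ho).
Local Notation lword := (@lword k Hc Ho).
Variables (Delta : {linear C -> tensor C C}) (eps : {linear C -> k^o}).
Hypothesis DeltaE : is_lcoproduct Delta.
Hypothesis epsE : forall u v, eps (lword u v) = (nilp u && nilp v)%:R.

Lemma coder1_word (D : {linear C -> C}) : coder1 Delta eps D -> coder_word Delta 1 D.
Proof.
move=> [[T1 [T2 [T1E T2E TD]]] _ _] u v.
rewrite -TD DeltaE !usum_linear -usumD; apply: eq_usum => a b _ _.
rewrite !csum_linear -csumD; apply: eq_csum => x y _.
rewrite !linearZ /= -scalerDr (T1E _ _ _ (lword_deg a x)) (T2E _ _ _ (lword_deg a x)).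
by rewrite mul0r expr0z scale1r.
Qed.

(** The Koszul tensor of the identity with [D] is realised as [sigma] tensor [D], where [sigma]
    multiplies an element of degree d by the sign of d and is linear on the whole coalgebra. *)
Lemma coder_word_coder1 (D : {linear C -> C}) : coder_word Delta 1 D ->
  (forall u v, eps (D (lword u v)) = 0) ->
  (forall u v, coalg_deg (deg u + deg v + 1) (D (lword u v))) -> coder1 Delta eps D.
Proof.
move=> cD eD dD; split; last 1 first.
- move=> e x; elim=> [|c _ z [du [u [dv [v [hu hv de ->]]]]] _ IH].
    by rewrite linear0; exact: span0.
  have [[w [wd wv]] [t [td tv]]] := (homogeneous_letters hu, homogeneous_letters hv).
  rewrite linearP; apply: spanD IH; apply: spanZ.
  by have := dD w t; rewrite /deg wd td de /lword wv tv.
- have [sigma sigmaE] := degree_scaling_ex Hc Ho sg.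
  have [||T1 T1E] := @tensor_lift k C C _ (fun x y => tens (D x) y).
  + by move=> y c x x'; rewrite linearP tens_linl.
  + by move=> x c y y'; rewrite tens_linr.
  have [||T2 T2E] := @tensor_lift k C C _ (fun x y => tens (sigma x) (D y)).
  + by move=> y c x x'; rewrite linearP tens_linl.
  + by move=> x c y y'; rewrite linearP tens_linr.
  exists T1, T2; split.
  + by move=> d x y _; rewrite T1E mul0r expr0z scale1r.
  + by move=> d x y /(degree_scalingE sigmaE) E; rewrite T2E E tensZl mul1r.
  apply: (coalg_ext (f := fun x => T1 (Delta x) + T2 (Delta x))
    (g := fun x => Delta (D x))) => [c y z|c y z|u v].
  + by rewrite !linearP /= scalerDr addrACA.
  + by rewrite !linearP.
  rewrite cD DeltaE !usum_linear -usumD; apply: eq_usum => a b _ _.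
  rewrite !csum_linear -csumD; apply: eq_csum => x y _.
  rewrite !linearZ /= -scalerDr T1E T2E (degree_scalingE sigmaE (lword_deg a x)).
  by rewrite mul1r tensZl.
- apply: (@coalg_ext k Hc Ho k^o (fun x => eps (D x)) (fun=> 0)) => [c y z|c y z|//]; first by rewrite !linearP.
  by rewrite scaler0 addr0.
Qed.

(** The two mixed terms [tens (D x) (D y)] cancel: one takes its sign before [D] raises the degree
    of the first factor, the other after. *)
Lemma coder_square (D : {linear C -> C}) : coder1 Delta eps D ->
  coder_word Delta 0 (fun x => D (D x)).
Proof.
move=> cD; have [[T1 [T2 [T1E T2E TD]]] _ dD] := cD.
move=> u v; rewrite -TD coder1_word // !usum_linear -usumD; apply: eq_usum => a b _ _.
rewrite !csum_linear -csumD; apply: eq_csum => x y _.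
rewrite !linearZ /= -scalerDr; congr (_ *: _); rewrite !linearD !linearZ /=.
have hd := lword_deg a x; have hd' := dD _ _ hd.
rewrite (T1E _ _ _ hd) (T1E _ _ _ hd') (T2E _ _ _ hd) (T2E _ _ _ hd').
set e := deg a + deg x; rewrite !mul0r !mul1r !expr0z sg0 !scale1r.
have -> : (-1) ^ (e + 1) = - sg e :> k by rewrite -[LHS]/(sg _) sgD [sg 1]expr1z mulrN1.
rewrite scaleNr -addrA; congr (_ + _); rewrite addrA subrr add0r.
by rewrite scalerA -[(-1) ^ e]/(sg e) -sgD (@sg_eq _ _ 0) ?sg0 ?scale1r // parD addbb.
Qed.

Lemma usum_cat_symmetric (V : lmodType k) (g : seq (letter Hc) -> V) u :
  letter_symmetric g ->
  usum u (fun a b => g (a ++ b)) = (2 ^ size u)%:R *: g u.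
Proof.
elim: u g => [|x u IH] g sym_g /=; first by rewrite scale1r.
transitivity (usum u (fun a b => 2%:R *: g (x :: a ++ b))).
  apply: eq_usum => a b _ _; rewrite (letter_symmetric_move _ _ _ sym_g) scaler_nat.
  by rewrite mulr2n.
rewrite usumZ (IH (fun w => g (x :: w))).
  by rewrite scalerA -natrM expnS.
by move=> a b; exact: (sym_g (x :: a) b).
Qed.

Lemma csum_const (T : Type) (V : lmodType k) (v : seq T) (x : V) :
  csum v (fun _ _ => x) = (size v).+1%:R *: x.
Proof.
elim: v => [|y v IH] /=; first by rewrite scale1r.
by rewrite IH [in RHS]mulrSr scalerDl scale1r addrC.
Qed.

(** Multiplying back undoes the sign of the coproduct, so every unshuffle and every cut returns the
    original word. *)
Lemma product_ex : exists M : {linear tensor C C -> C},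
  (forall a x b y, M (tens (lword a x) (lword b y))
     = sg (deg b * deg x) *: lword (a ++ b) (x ++ y))
  /\ forall u v, M (Delta (lword u v)) = (2 ^ size u * (size v).+1)%:R *: lword u v.
Proof.
have [|||||| M ME] := @coalg2_lift k Hc Ho C
  (fun a x b y => sg (deg b * deg x) *: lword (a ++ b) (x ++ y)).
- move=> x b y; apply: (lmultilinear_sg (fun _ => deg b * deg x)).
  exact: (lmultilinear_catr b (@lword_multilinearl _ _ _ (x ++ y))).
- move=> x b y; apply: (lsymmetric_sg (fun _ => deg b * deg x)).
  exact: (lsymmetric_catr b (@lword_symmetricl _ _ _ (x ++ y))).
- move=> a b y; apply: (lmultilinear_sg (fun d => deg b * d)).
  exact: (lmultilinear_catr y (@lword_multilinearr _ _ _ (a ++ b))).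
- move=> a x y; apply: (lmultilinear_sg (fun d => d * deg x)).
  exact: (lmultilinear_catl a (@lword_multilinearl _ _ _ (x ++ y))).
- move=> a x y; apply: (lsymmetric_sg (fun d => d * deg x)).
  exact: (lsymmetric_catl a (@lword_symmetricl _ _ _ (x ++ y))).
- move=> a x b; apply: (lmultilinear_sg (fun _ => deg b * deg x)).
  exact: (lmultilinear_catl x (@lword_multilinearr _ _ _ (a ++ b))).
exists M; split=> // u v; rewrite DeltaE usum_linear.
transitivity (usum u (fun a b => csum v (fun _ _ => lword (a ++ b) v))).
  apply: eq_usum => a b _ _; rewrite csum_linear; apply: eq_csum => x y <-.
  rewrite linearZ /= ME sgZZ (@sg_eq _ _ 0) ?sg0Z // parD addbb.
  by [].
rewrite usum_csum csum_const (usum_cat_symmetric u (@lword_symmetricl _ _ _ v)).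
by rewrite scalerA -natrM mulnC.
Qed.

Definition unit_word : C := lword [::] [::].

Hypothesis char0 : [pchar k] =i pred0.

Variables (pc : {linear C -> Hc}) (po : {linear C -> Ho}).
Hypothesis pcE : forall u v, pc (lword u v)
  = if v is [::] then if u is [:: x] then lval x else 0 else 0.
Hypothesis poE : forall u v, po (lword u v)
  = if u is [::] then if v is [:: x] then lval x else 0 else 0.

(* The product composed with the coproduct multiplies words of m closed and n
   open letters by 2^m (n+1), and a primitive element by 2; these numbers agree
   only on single letters. *)
Lemma primitive_eq0 (x : C) :
  Delta x = tens x unit_word + tens unit_word x -> pc x = 0 -> po x = 0 -> x = 0.
Proof.
have [M [ME MD]] := product_ex.
have Mr y : M (tens y unit_word) = y.
  move: y; apply: (@coalg_ext k Hc Ho C (fun y => M (tens y unit_word)) id) => // [c z t|u v].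
    by rewrite tens_linl linearP.
  by rewrite ME deg_nil mul0r sg0Z !cats0.
have Ml y : M (tens unit_word y) = y.
  move: y; apply: (@coalg_ext k Hc Ho C (fun y => M (tens unit_word y)) id) => // [c z t|u v].
    by rewrite tens_linr linearP.
  by rewrite ME deg_nil mulr0 sg0Z.
(* On single letters the number to invert is 0, whose inverse is 0 by convention, so [R] kills
   them. *)
have [R RE] := size_scaling_ex Hc Ho (fun m n => ((2 ^ m * n.+1)%:R - 2%:R)^-1).
(* Every element is recovered from the defect of the eigenvalue equation M Delta y = 2 y together
   with its two letter components. *)
have key y : y = R (M (Delta y) - 2%:R *: y) + word [:: pc y] [::] + word [::] [:: po y].
  move: y; apply: (@coalg_ext k Hc Ho C id (fun y => R (M (Delta y) - 2%:R *: y)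
    + word [:: pc y] [::] + word [::] [:: po y])) => // [c z t|u v].
    have wl : word [:: pc (c *: z + t)] [::] = c *: word [:: pc z] [::] + word [:: pc t] [::] :> C.
      by rewrite linearP /word (wedge_word_multilinear [::] [::]) tens_linl.
    have wr : word [::] [:: po (c *: z + t)] = c *: word [::] [:: po z] + word [::] [:: po t] :> C.
      by rewrite linearP /word (tensor_word_multilinear [::] [::]) tens_linr.
    have MR : R (M (Delta (c *: z + t)) - 2%:R *: (c *: z + t))
        = c *: R (M (Delta z) - 2%:R *: z) + R (M (Delta t) - 2%:R *: t).
      rewrite -linearP; congr (R _); rewrite (linearP Delta) (linearP M).
      by rewrite scalerDr scalerBr opprD addrACA !scalerA mulrC.
    rewrite wl wr MR (addrACA (c *: R _)) (addrACA (c *: R _ + _)).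
    by rewrite -!scalerDr.
  rewrite MD -scalerBl linearZ /= RE pcE poE scalerA.
  have wc0 : word [:: 0] [::] = 0 :> C := multilinear0 [::] [::] (word_multilinearl [::]).
  have wo0 : word [::] [:: 0] = 0 :> C := multilinear0 [::] [::] (word_multilinearr [::]).
  have E (N : nat) (w : C) : N != 2 -> w = ((N%:R - 2%:R) * (N%:R - 2%:R)^-1) *: w.
    move=> N2; rewrite divff ?scale1r //; move/pcharf0P: char0 => ch.
    case: (leqP 2 N) => h; first by rewrite -natrB // ch subn_eq0 -ltnNge ltn_neqAle eq_sym N2.
    by rewrite -opprB oppr_eq0 -natrB ?ch ?subn_eq0 -?ltnNge // ltnW.
  case: u => [|x1 [|x2 u]].
  + case: v => [|y1 [|y2 v]]; rewrite wc0 ?wo0 ?addr0; [exact: E | | exact: E].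
    by rewrite subrr mul0r scale0r add0r.
  + case: v => [|y1 v]; rewrite wo0 ?wc0 ?addr0.
      by rewrite subrr mul0r scale0r add0r.
    by apply: E; rewrite expn1 /=; lia.
  have -> : (if v is [::] then 0 else 0) = 0 :> Hc by case: v.
  by rewrite wo0 wc0 !addr0; apply: E; rewrite /= !expnS; lia.
move=> Dx pcx pox.
have Mx : M (Delta x) = 2%:R *: x by rewrite Dx (linearD M) Mr Ml scaler_nat mulr2n.
rewrite (key x) pcx pox Mx subrr (linear0 R).
by rewrite (multilinear0 [::] [::] (word_multilinearl [::])) (multilinear0 [::] [::] (word_multilinearr [::])) !addr0.
Qed.

Lemma coder_word_eq0 e (E : C -> C) : coder_word Delta e E ->
  (forall u v, pc (E (lword u v)) = 0) -> (forall u v, po (E (lword u v)) = 0) ->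
  forall u v, E (lword u v) = 0.
Proof.
move=> cE pcE0 poE0 u v; have [N] := ubnP (size u + size v)%N.
elim: N u v => // N IH u v; rewrite ltnS => szN.
apply: primitive_eq0 (pcE0 u v) (poE0 u v); rewrite cE.
(* Any split other than the two extreme ones feeds [E] a strictly shorter word, on which it vanishes
   by induction; the extreme splits carry no sign. *)
transitivity
  (usum u (fun a b => csum v (fun x y =>
     if nilp b && nilp y then tens (E (lword a x)) unit_word else 0))
  + usum u (fun a b => csum v (fun x y =>
     if nilp a && nilp x then tens unit_word (E (lword b y)) else 0))).
  rewrite -usumD; apply: eq_usum => a b _ ab; rewrite -csumD; apply: eq_csum => x y xy.
  have szv : (size x + size y)%N = size v by rewrite -xy size_cat.
  rewrite scalerDr sgZZ; congr (_ + _).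
    case: b y ab szv {xy} => [|b1 b] [|y1 y] /= ab szv;
      rewrite ?deg_nil ?mul0r ?sg0Z //; rewrite (IH a x) ?tens0l ?scaler0 //; lia.
  case: a x ab szv {xy} => [|a1 a] [|x1 x] /= ab szv;
    rewrite ?deg_nil ?addr0 ?mulr0 ?addr0 ?sg0Z //; rewrite (IH b y) ?tens0r ?scaler0 //; lia.
congr (_ + _).
  rewrite usum_extremer => [|a x b]; last by rewrite csum0.
  by rewrite csum_extremer // => a x b; rewrite andbF.
rewrite usum_extremel => [|a x b]; last by rewrite csum0.
by rewrite csum_extremel // => a x b; rewrite andbF.
Qed.
End Vanishing.

(** * Lifts and the OCHA relations *)

Section Relations.
Variables (k : fieldType) (Hc Ho : gradedSpace k).
Local Notation C := (coalg Hc Ho).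
Local Notation lword := (@lword k Hc Ho).
Variables (l : seq Hc -> Hc) (n : seq Hc -> seq Ho -> Ho).
Hypotheses (Hl : closed_ops l) (Hn : open_ops n).

Lemma sum_nat1 (V : nmodType) m (G : nat -> V) : G 0 = 0 ->
  \sum_(1 <= p < m.+1) G p = \sum_(p < m.+1) G p.
Proof. by move=> G0; rewrite -(big_mkord xpredT G) [RHS]big_ltn // G0 add0r. Qed.

Lemma closed_lift_sum (w : seq (letter Hc)) (v : seq Ho) :
  \sum_(1 <= p < (size (vals w)).+1) closed_lift l p (degs w) (vals w) v
  = usum w (fun a b => word (l (vals a) :: vals b) v).
Proof.
have [l0 _ _ _] := Hl.
rewrite sum_nat1; last first.
  rewrite /closed_lift leq0n big1 // => s _.
  by rewrite take0 l0 (multilinear0 [::] _ (word_multilinearl v)) scaler0.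
pose G (da : seq int) (va : seq Hc) (db : seq int) vb : C := word (l va :: vb) v.
transitivity (usum w (fun a b => G (degs a) (vals a) (degs b) (vals b))); last by [].
rewrite usum_permute; apply: eq_bigr => p _.
by rewrite /closed_lift -ltnS ltn_ord.
Qed.

Lemma open_lift_sum (w : seq (letter Hc)) (t : seq (letter Ho)) :
  \sum_(p < (size (vals w)).+1) \sum_(q < (size (vals t)).+1 | (0 < p + q)%N)
    open_lift n p q (degs w) (vals w) (degs t) (vals t)
  = open_lift_word Hn w t.
Proof.
have [n0 _ _ _] := Hn; set N := size (vals w); set M := size (vals t).
pose G (da : seq int) (va : seq Hc) (db : seq int) vb : C :=
  \sum_(q < M.+1) \sum_(j < (M - q).+1)
    sg (degsum da + degsum (take j (degs t)) + degsum (take j (degs t)) * degsum db)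
    *: word va (take j (vals t) ++ n vb (take q (drop j (vals t))) :: drop (j + q) (vals t)).
transitivity (usum w (fun a b => G (degs a) (vals a) (degs b) (vals b))); last first.
  apply: eq_usum => a b _ _; rewrite csum2_take_drop /G /M size_map.
  apply: eq_bigr => q _; apply: eq_bigr => j _.
  by rewrite /lword /deg /degs /vals map_cat /= /vals !(map_drop, map_take).
(* [open_lift] counts the inputs of the operation, which form the second block, while [usum] counts
   the first block: hence [p] becomes [N - p]. *)
rewrite usum_permute (reindex_inj rev_ord_inj); apply: eq_bigr => p _.
have pE : (N - (N - p))%N = p by rewrite subKn // -ltnS.
transitivity (\sum_(q < M.+1) open_lift n (N - p) q (degs w) (vals w) (degs t) (vals t)).
  (* The excluded term, with no input at all, is zero because [n [::] [::] = 0]. *)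
  rewrite big_mkcond; apply: eq_bigr => q _; rewrite /= subSS; case: ifP => // h.
  have [-> ->] : (N - p)%N = 0 /\ nat_of_ord q = 0 by move: h; lia.
  rewrite /open_lift /= subn0 big1 // => s _; rewrite big1 // => j _.
  rewrite take0 [drop _ (permute s (vals w))]drop_oversize ?n0; last by rewrite size_map size_enum_ord.
  by rewrite (multilinear0 (take j (vals t)) (drop (j + 0) (vals t)) (word_multilinearr _)) scaler0.
transitivity (\sum_(q < M.+1) \sum_(s : 'S_N | unshuffle p s) \sum_(j < (M - q).+1)
  (-1) ^ koszul s (degs w) *: (sg (degsum (take p (permute s (degs w)))
     + degsum (take j (degs t)) + degsum (take j (degs t)) * degsum (drop p (permute s (degs w))))
    *: word (take p (permute s (vals w)))
      (take j (vals t) ++ n (drop p (permute s (vals w))) (take q (drop j (vals t)))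
        :: drop (j + q) (vals t)) : C)).
  apply: eq_bigr => q _; rewrite /open_lift leq_subr -ltnS ltn_ord /= -/N pE.
  apply: eq_bigr => s _; apply: eq_bigr => j _.
  by rewrite -[(-1) ^ koszul _ _]/(sg _) sgZZ !addrA.
rewrite exchange_big; apply: eq_bigr => s _ /=.
by rewrite /G scaler_sumr; apply: eq_bigr => q _; rewrite scaler_sumr.
Qed.

Lemma is_liftP (D : {linear C -> C}) : is_lift l n D <-> is_lift_word Hl Hn D.
Proof.
split=> DE.
  move=> u v; rewrite [LHS](DE _ _ _ _ (letters_homogeneous u) (letters_homogeneous v)).
  by rewrite closed_lift_sum open_lift_sum.
move=> du u dv v /homogeneous_letters[w [<- <-]] /homogeneous_letters[t [<- <-]].
by rewrite closed_lift_sum open_lift_sum -DE.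
Qed.

(** On one letter the sum reduces to [l (l x)], so l_1^2 = 0 is the case of length one; for an
    arbitrary vector it follows by expansion into letters. On the empty word both sides vanish. *)
Lemma Linfty_relationsP : Linfty_relations l <->
  forall u : seq (letter Hc), usum u (fun a b => l (l (vals a) :: vals b)) = 0.
Proof.
have [l0 ml _ _] := Hl.
have sumE w : \sum_(1 <= p < (size (vals w)).+1)
    \sum_(s : 'S_(size (vals w)) | unshuffle p s) (-1) ^ koszul s (degs w) *:
      l (l (take p (permute s (vals w))) :: drop p (permute s (vals w)))
    = usum w (fun a b => l (l (vals a) :: vals b)).
  rewrite sum_nat1; last first.
    by rewrite big1 // => s _; rewrite take0 l0 (multilinear0 [::] _ ml) scaler0.
  by rewrite (usum_permute w (fun _ va _ vb => l (l va :: vb))).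
split=> [[l1 rel] u|rel].
  case: (leqP 2 (size (vals u))) => h.
    by rewrite -sumE; apply: rel h; exact: letters_homogeneous.
  case: u h => [|x [|y u]] //= _.
    by rewrite l0 (multilinear0 [::] _ ml).
  by rewrite l0 l1 (multilinear0 [::] _ ml) scaler0 addr0.
split=> [x|d v /homogeneous_letters[w [<- <-]] _]; last by rewrite sumE.
rewrite -(decompE x) (multilinear_sum [::] [::]) //= (multilinear_sum [::] [::]) //=.
rewrite big1 // => e _; have := rel [:: e] => /=.
by rewrite l0 (multilinear0 [::] _ ml) scaler0 addr0.
Qed.

Lemma open_closed_relationsP : open_closed_relations l n <->
  forall (u : seq (letter Hc)) (v : seq (letter Ho)),
    usum u (fun a b => n (l (vals a) :: vals b) (vals v))
    + usum u (fun a b => csum v (fun x yz => csum yz (fun y z =>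
        sg (deg a + deg x + deg x * deg b)
        *: n (vals a) (vals x ++ n (vals b) (vals y) :: vals z)))) = 0.
Proof.
have [l0 _ _ _] := Hl.
have mn a : multilinear (n^~ a) by case: Hn => _ h _ _; case: (h a).
have sum1 w (v : seq Ho) : \sum_(1 <= p < (size (vals w)).+1)
    \sum_(s : 'S_(size (vals w)) | unshuffle p s) (-1) ^ koszul s (degs w) *:
      n (l (take p (permute s (vals w))) :: drop p (permute s (vals w))) v
    = usum w (fun a b => n (l (vals a) :: vals b) v).
  rewrite sum_nat1; last first.
    by rewrite big1 // => s _; rewrite take0 l0 (multilinear0 [::] _ (mn v)) scaler0.
  by rewrite (usum_permute w (fun _ va _ vb => n (l va :: vb) v)).
have sum2 (w : seq (letter Hc)) (t : seq (letter Ho)) :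
  \sum_(p < (size (vals w)).+1) \sum_(s : 'S_(size (vals w)) | unshuffle p s)
       \sum_(q < (size (vals t)).+1) \sum_(i < (size (vals t) - q).+1)
         (-1) ^ (koszul s (degs w) + (degsum (take p (permute s (degs w)))
                 + degsum (take i (degs t)))
                 + degsum (take i (degs t)) * degsum (drop p (permute s (degs w)))) *:
         n (take p (permute s (vals w)))
           (take i (vals t) ++ n (drop p (permute s (vals w))) (take q (drop i (vals t)))
              :: drop (i + q) (vals t))
  = usum w (fun a b => csum t (fun x yz => csum yz (fun y z =>
        sg (deg a + deg x + deg x * deg b)
        *: n (vals a) (vals x ++ n (vals b) (vals y) :: vals z)))).
  pose M := size (vals t).
  pose G (da : seq int) (va : seq Hc) (db : seq int) vb : Ho :=
    \sum_(q < M.+1) \sum_(j < (M - q).+1)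
      sg (degsum da + degsum (take j (degs t)) + degsum (take j (degs t)) * degsum db)
      *: n va (take j (vals t) ++ n vb (take q (drop j (vals t))) :: drop (j + q) (vals t)).
  transitivity (usum w (fun a b => G (degs a) (vals a) (degs b) (vals b))); last first.
    apply: eq_usum => a b _ _; rewrite csum2_take_drop /G /M size_map.
    apply: eq_bigr => q _; apply: eq_bigr => j _.
    by rewrite /deg /degs /vals !(map_drop, map_take).
  rewrite usum_permute; apply: eq_bigr => p _; apply: eq_bigr => s _.
  rewrite /G scaler_sumr; apply: eq_bigr => q _; rewrite scaler_sumr; apply: eq_bigr => j _.
  by rewrite -[(-1) ^ koszul _ _]/(sg _) sgZZ !addrA.
split=> [rel u v|rel d v e a /homogeneous_letters[w [<- <-]] /homogeneous_letters[t [<- <-]]].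
  by rewrite -sum1 -sum2; apply: rel; exact: letters_homogeneous.
by rewrite sum1 sum2.
Qed.

Variables (pc : {linear C -> Hc}) (po : {linear C -> Ho}).
Hypothesis pcE : forall u v, pc (lword u v)
  = if v is [::] then if u is [:: x] then lval x else 0 else 0.
Hypothesis poE : forall u v, po (lword u v)
  = if u is [::] then if v is [:: x] then lval x else 0 else 0.
Variable D : {linear C -> C}.
Hypothesis DE : is_lift_word Hl Hn D.

Lemma pc_open a x y z : pc (lword a (x ++ y :: z)) = 0.
Proof. by rewrite pcE; case: x. Qed.

(** A closed lift leaves a single closed letter only if [l] takes all letters, and an open lift
    always leaves an open letter. *)
Lemma pc_lift u v : pc (D (lword u v)) = if v is [::] then l (vals u) else 0.
Proof.
rewrite DE linearD /closed_lift_word usum_linear usum_extremer => [|a x b]; last by rewrite pcE; case: v.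
rewrite pcE /= [X in _ + X](_ : _ = 0) ?addr0 //.
rewrite /open_lift_word usum_linear -[RHS](usum0 _ u); apply: eq_usum => a b _ _.
rewrite csum_linear -[RHS](csum0 _ v); apply: eq_csum => x yz _.
rewrite csum_linear -[RHS](csum0 _ yz); apply: eq_csum => y z _.
by rewrite linearZ /= pc_open scaler0.
Qed.

(** A closed lift always leaves a closed letter, and an open lift leaves a single open letter only
    if the operation takes all letters. *)
Lemma po_lift u v : po (D (lword u v)) = n (vals u) (vals v).
Proof.
rewrite DE linearD [X in X + _](_ : _ = 0) ?add0r; last first.
  rewrite /closed_lift_word usum_linear -[RHS](usum0 _ u); apply: eq_usum => a b _ _.
  by rewrite poE.
rewrite /open_lift_word usum_linear usum_extremel => [|a x b]; last first.
  rewrite csum_linear -[RHS](csum0 _ v); apply: eq_csum => y yz _.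
  rewrite csum_linear -[RHS](csum0 _ yz); apply: eq_csum => z t _.
  by rewrite linearZ /= poE scaler0.
rewrite csum_linear csum_extremel => [|x y z]; last first.
  rewrite csum_linear -[RHS](csum0 _ z); apply: eq_csum => p q _.
  by rewrite linearZ /= poE; case: y => [|y1 y] /=; rewrite scaler0.
rewrite csum_linear csum_extremer => [|x y z].
  by rewrite linearZ /= poE !deg_nil !add0r mul0r sg0Z.
by rewrite linearZ /= poE scaler0.
Qed.

Lemma pc_lift2 u v : pc (D (D (lword u v)))
  = if v is [::] then usum u (fun a b => l (l (vals a) :: vals b)) else 0.
Proof.
rewrite DE !linearD [X in _ + X](_ : _ = 0) ?addr0; last first.
  rewrite /open_lift_word !usum_linear -[RHS](usum0 _ u); apply: eq_usum => a b _ _.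
  rewrite !csum_linear -[RHS](csum0 _ v); apply: eq_csum => x yz _.
  rewrite !csum_linear -[RHS](csum0 _ yz); apply: eq_csum => y z _.
  by rewrite !linearZ /= pc_lift; case: x => [|x1 x] /=; rewrite scaler0.
rewrite /closed_lift_word !usum_linear.
case: v => [|y v]; last first.
  by rewrite -[RHS](usum0 _ u); apply: eq_usum => a b _ _; rewrite pc_lift.
by apply: eq_usum => a b _ _; rewrite pc_lift.
Qed.

Lemma po_lift2 u v : po (D (D (lword u v)))
  = usum u (fun a b => n (l (vals a) :: vals b) (vals v))
    + usum u (fun a b => csum v (fun x yz => csum yz (fun y z =>
        sg (deg a + deg x + deg x * deg b)
        *: n (vals a) (vals x ++ n (vals b) (vals y) :: vals z)))).
Proof.
rewrite DE !linearD; congr (_ + _).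
  by rewrite /closed_lift_word !usum_linear; apply: eq_usum => a b _ _; rewrite po_lift.
rewrite /open_lift_word !usum_linear; apply: eq_usum => a b _ _.
rewrite !csum_linear; apply: eq_csum => x yz _.
rewrite !csum_linear; apply: eq_csum => y z _.
by rewrite !linearZ /= po_lift /vals map_cat.
Qed.
End Relations.

(** * Open stability *)

(* By Zorn's lemma there is a maximal subspace containing x and not y; it is a
   complement of the line of y. *)
Lemma separating_functional (k : fieldType) (V : lmodType k) (x y : V) :
  (forall c, y <> c *: x) -> exists L : {linear V -> k^o}, L x = 0 /\ L y = 1.
Proof.
move=> yx.
pose ok (U : V -> Prop) :=
  [/\ U x, ~ U y & forall c a b, U a -> U b -> U (c *: a + b)].
pose T := {U : V -> Prop | ok U}.
pose R (s t : T) := `[< forall z, sval s z -> sval t z >].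
have ok0 : ok (fun z => exists c, z = c *: x).
  split; first by exists 1; rewrite scale1r.
    by case=> c /yx.
  by move=> c _ _ [d ->] [e ->]; exists (c * d + e); rewrite scalerDl scalerA.
have [|r s t /asboolP rs /asboolP st|A totA|[U [Ux Uy Ulin]] maxU] :=
    @classical_sets.ZL_preorder T (exist _ _ ok0) R.
- by move=> t; apply/asboolP.
- by apply/asboolP => z /rs /st.
- have [[t0 At0]|A0] := pselect (exists t, A t); last first.
    by exists (exist _ _ ok0) => s As; case: A0; exists s.
  have okA : ok (fun z => exists2 t, A t & sval t z).
    split; first by exists t0 => //; case: (svalP t0).
      by case=> t _; case: (svalP t).
    move=> c a b [s As sa] [t At tb].
    case: (totA s t As At) => /asboolP st; [exists t => // | exists s => //].
      by case: (svalP t) => _ _; apply=> //; exact: st.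
    by case: (svalP s) => _ _; apply=> //; exact: st.
  by exists (exist _ _ okA) => s As; apply/asboolP => z sz; exists s.
have {}maxU U' : ok U' -> (forall z, U z -> U' z) -> forall z, U' z -> U z.
  by move=> okU' UU'; have /asboolP := maxU (exist _ U' okU') (asboolT UU').
have U0 : U 0 by rewrite -(addNr x) -scaleN1r; exact: Ulin.
have UZ c a : U a -> U (c *: a) by move=> Ua; rewrite -[_ *: _]addr0; exact: Ulin.
have UD a b : U a -> U b -> U (a + b) by move=> Ua Ub; rewrite -[a]scale1r; exact: Ulin.
(* If [h] is outside [U], then by maximality U + k h contains [y]; the coefficient of [h] there is
   nonzero since [y] is not in [U]. *)
have ex h : exists c, U (h - c *: y).
  have [Uh|nUh] := pselect (U h); first by exists 0; rewrite scale0r subr0.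
  pose U' z := exists u a, U u /\ z = u + a *: h.
  have UU' z : U z -> U' z by move=> Uz; exists z, 0; rewrite scale0r addr0.
  have [[u [a [Uu yE]]]|nU'y] := pselect (U' y); last first.
    have okU' : ok U'.
      split=> //; first exact: UU'.
      move=> c _ _ [u [a [Uu ->]]] [v [b [Uv ->]]]; exists (c *: u + v), (c * a + b).
      by split; [exact: Ulin | rewrite scalerDr addrACA scalerDl scalerA].
    by case: nUh; apply: (maxU _ okU' UU'); exists 0, 1; rewrite scale1r add0r.
  have a0 : a != 0.
    by apply/eqP => a0; apply: Uy; rewrite yE a0 scale0r addr0.
  exists a^-1; rewrite yE scalerDr scalerA mulVf // scale1r opprD addrCA subrr addr0.
  by rewrite -scaleNr; exact: UZ.
have [lam lamE] := choice ex.
(* Choice yields a bare function; uniqueness of the coefficient makes it linear. *)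
have lam_uniq h c : U (h - c *: y) -> lam h = c.
  move=> hc; apply/eqP/negPn/negP => ne; apply: Uy.
  have /(UZ (c - lam h)^-1) : U ((c - lam h) *: y).
    rewrite scalerBl -[_ - _](_ : (h - lam h *: y) + -1 *: (h - c *: y) = _).
      by apply: UD => //; exact: UZ.
    by rewrite scaleN1r opprB addrC addrA subrK.
  by rewrite scalerA mulVf ?scale1r // subr_eq0 eq_sym.
have [|L LE] := @linear_pack k V k^o lam.
  move=> c a b; apply: lam_uniq.
  rewrite -[_ - _](_ : c *: (a - lam a *: y) + (b - lam b *: y) = _); first exact: Ulin.
  by rewrite scalerBr addrACA -opprD scalerDl scalerA.
exists L; rewrite !LE; split; apply: lam_uniq; rewrite ?scale0r ?subr0 //.
by rewrite scale1r subrr.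
Qed.

Section FunctionalLift.
Variables (k : fieldType) (M N V W : lmodType k).

Lemma tensor_lift_functional_l (a : {linear M -> k^o}) (g : {linear N -> W}) :
  exists F : {linear tensor M N -> W}, forall s t, F (tens s t) = (a s : k) *: g t.
Proof.
apply: tensor_lift => [t c x y|s c x y].
  by rewrite linearP scalerDl scalerA.
by rewrite linearP scalerDr !scalerA mulrC.
Qed.

Lemma tensor_lift_functional_r (a : {linear N -> k^o}) (g : {linear M -> W}) :
  exists F : {linear tensor M N -> W}, forall s t, F (tens s t) = (a t : k) *: g s.
Proof.
apply: tensor_lift => [t c x y|s c x y].
  by rewrite linearP scalerDr !scalerA mulrC.
by rewrite linearP scalerDl scalerA.
Qed.

Lemma linear_comp_ex (f : {linear V -> M}) (g : {linear M -> W}) :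
  exists F : {linear V -> W}, forall x, F x = g (f x).
Proof. by apply: linear_pack => c x y; rewrite !linearP. Qed.

Lemma linear_add_ex (f g : {linear V -> W}) :
  exists F : {linear V -> W}, forall x, F x = f x + g x.
Proof. by apply: linear_pack => c x y; rewrite !linearP scalerDr addrACA. Qed.
End FunctionalLift.

Section OpenStable.
Variables (k : fieldType) (Hc Ho : gradedSpace k).
Local Notation C := (coalg Hc Ho).
Local Notation lword := (@lword k Hc Ho).

Lemma word_lword_span (u : seq Hc) (v : seq Ho) :
  span (fun y => exists a x, size x = size v /\ y = lword a x) (word u v).
Proof.
apply: span_trans (word_span v (word_multilinearr u)) _ => _ [x [xv ->]].
apply: span_trans (word_span u (word_multilinearl (vals x))) _ => _ [a [_ ->]].
by apply: span_gen; exists a, x.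
Qed.

Variable P : {linear C -> C}.
Hypothesis PE : forall u v, P (lword u v) = (size v == 0)%:R *: lword u v.

Lemma open_partP x : open_part x <-> P x = 0.
Proof.
split=> [|Px].
  elim=> [|c _ z [u [v [v0 ->]]] _ IH]; first exact: linear0.
  rewrite linearP IH addr0.
  have : span (fun=> False) (P (word u v)).
    apply: span_map (word_lword_span u v) _ => _ [a [t [tv ->]]].
    by rewrite PE tv size_eq0; case: eqP => // _; rewrite scale0r; exact: span0.
  by move: (P _) => t; case=> [|? ? ? []]; rewrite scaler0.
(* [x] is replaced by [x - P x], and w - P w lies in the open part for every word w. *)
rewrite -[x]subr0 -Px; elim: (coalg_span x) => [|c _ z [u [v ->]] _ IH].
  by rewrite linear0 subr0; exact: span0.
rewrite linearP opprD addrACA; apply: spanD IH; rewrite -scalerBr; apply: spanZ.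
rewrite PE; case: v => [|y v]; first by rewrite scale1r subrr; exact: span0.
by rewrite scale0r subr0; apply: span_gen; exists (vals u), (vals (y :: v)).
Qed.

Lemma open_stable_words (D : {linear C -> C}) :
  (forall u y v, P (D (lword u (y :: v))) = 0) -> open_stable D.
Proof.
move=> PD x xo; apply: span_map xo _ => _ [u [v [v0 ->]]].
apply: (span_trans (P := @open_part k Hc Ho)) => //.
apply: span_map (word_lword_span u v) _ => _ [a [t [tv ->]]].
apply/span_gen/open_partP; case: t tv => [/esym/size0nil/v0|] //.
Qed.

Variable Delta : {linear C -> tensor C C}.
Hypothesis DeltaE : is_lcoproduct Delta.
Variable po : {linear C -> Ho}.
Hypothesis poE : forall u v, po (lword u v)
  = if u is [::] then if v is [:: x] then lval x else 0 else 0.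

Lemma coalg2_ext_linear (W : lmodType k) (f g : {linear tensor C C -> W}) :
  (forall u v, f (Delta (lword u v)) = g (Delta (lword u v))) ->
  forall x, f (Delta x) = g (Delta x).
Proof.
move=> E; apply: (@coalg_ext k Hc Ho W (fun x => f (Delta x)) (fun x => g (Delta x))) => //.
  by move=> c x y; rewrite !linearP.
by move=> c x y; rewrite !linearP.
Qed.

(* [Phi] reads off an open letter in the second factor, [Psi] in the first one,
   with the sign of exchanging the factors; they agree on coproducts. *)
Lemma flip_ex (lam : {linear Ho -> k^o}) : exists Phi Psi : {linear tensor C C -> C},
  [/\ forall s t, Phi (tens s t) = (lam (po t) : k) *: P s,
      forall d e s t, coalg_deg d s -> coalg_deg e t ->
        Psi (tens s t) = sg (d * e) *: ((lam (po s) : k) *: P t)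
    & forall x, Phi (Delta x) = Psi (Delta x)].
Proof.
have [sigma sigmaE] := degree_scaling_ex Hc Ho sg.
(* The sign (-1)^(d e) is made linear in the tensor by splitting on the parity of the second factor:
   no sign if [e] is even, the sign operator on the first factor if [e] is odd. *)
have [Ev EvE] := degree_scaling_ex Hc Ho (fun d => (~~ par d)%:R).
have [Od OdE] := degree_scaling_ex Hc Ho (fun d => (par d)%:R).
have [lpo lpoE] := linear_comp_ex po lam.
have [lpos lposE] := linear_comp_ex sigma lpo.
have [PEv PEvE] := linear_comp_ex Ev P.
have [POd POdE] := linear_comp_ex Od P.
have [Phi0 Phi0E] := tensor_lift_functional_r lpo P.
have PhiE s t : Phi0 (tens s t) = (lam (po t) : k) *: P s by rewrite Phi0E lpoE.
have [Psi0 Psi0E] := tensor_lift_functional_l lpo PEv.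
have [Psi1 Psi1E] := tensor_lift_functional_l lpos POd.
have [Psi PsiE] := linear_add_ex Psi0 Psi1.
have PsiE' d e s t : coalg_deg d s -> coalg_deg e t ->
    Psi (tens s t) = sg (d * e) *: ((lam (po s) : k) *: P t).
  move=> /(degree_scalingE sigmaE) sd te.
  rewrite PsiE Psi0E Psi1E PEvE POdE lposE !lpoE sd.
  rewrite (degree_scalingE (c := fun d => (~~ par d)%:R) EvE te).
  rewrite (degree_scalingE (c := fun d => (par d)%:R) OdE te).
  have lamZ c x : lam (po (c *: x)) = c * (lam (po x) : k) :> k.
    by rewrite (linearZ_LR po) (linearZ_LR lam).
  rewrite lamZ !(linearZ_LR P) !scalerA !sg_par parM -scalerDl.
  congr (_ *: _); case: (par d); case: (par e); rewrite /= ?expr0 ?expr1 ?mulr0 ?mulr1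
    ?addr0 ?add0r ?mul1r //.
exists Phi0, Psi; split=> //; apply: coalg2_ext_linear => u v.
(* On each side one split survives, with all closed letters in one factor and all open letters in
   the other. For [Psi] the sign of the coproduct cancels that of the exchange. *)
rewrite DeltaE !usum_linear usum_extremer => [|a z b]; last first.
  rewrite csum_linear -[RHS](csum0 _ v); apply: eq_csum => x y _.
  by rewrite linearZ /= PhiE poE linear0 scale0r scaler0.
rewrite csum_linear csum_extremel => [|z x y]; last first.
  by rewrite linearZ /= PhiE PE scale0r !scaler0.
rewrite usum_extremel => [|z a b]; last first.
  rewrite csum_linear -[RHS](csum0 _ v); apply: eq_csum => x y _.
  rewrite linearZ /= (PsiE' _ _ _ _ (lword_deg _ _) (lword_deg _ _)) poE.
  by rewrite linear0 scale0r !scaler0.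
rewrite csum_linear csum_extremer => [|x z y]; last first.
  rewrite linearZ /= (PsiE' _ _ _ _ (lword_deg _ _) (lword_deg _ _)) PE.
  by rewrite scale0r !scaler0.
rewrite !linearZ /= PhiE (PsiE' _ _ _ _ (lword_deg _ _) (lword_deg _ _)) sgZZ.
by rewrite !degE; signs.
Qed.
End OpenStable.

Section NotOneDimensional.
Variables (k : fieldType) (Hc Ho : gradedSpace k).
Local Notation C := (coalg Hc Ho).
Local Notation lword := (@lword k Hc Ho).

Lemma independent_letter (h : letter Ho) : ~ one_dimensional Ho -> lval h <> 0 ->
  exists y : letter Ho, forall c, lval y <> c *: lval h.
Proof.
move=> dim1 h0; apply: contrapT => /forallNP all_mul; apply: dim1.
exists (lval h); split=> // z; rewrite -(decompE z).
elim: (decomp z) => [|e s [c IH]]; first by exists 0; rewrite big_nil scale0r.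
have /existsNP[d /contrapT ed] := all_mul e.
by exists (d + c); rewrite big_cons IH ed scalerDl.
Qed.

Variables (Delta : {linear C -> tensor C C}) (eps : {linear C -> k^o}).
Hypothesis DeltaE : is_lcoproduct Delta.

(** The coproduct of [D] on the word (u; h v y) is read in two ways, with [lam h = 0] and
    [lam y = 1]. [Phi] reads off [y] and leaves P D (u; h v); [Psi] would read off [h], which [lam]
    kills. Terms where the letter read off is produced by [D] are the same on both sides and
    cancel. *)
Lemma coder1_open_stable (D : {linear C -> C}) :
  ~ one_dimensional Ho -> coder1 Delta eps D -> open_stable D.
Proof.
move=> dim1 cD; have [P PE] := size_scaling_ex Hc Ho (fun _ n => (n == 0)%:R).
have [po poE] := open_letter_proj Hc Ho.
have cw := coder1_word DeltaE cD; have [_ _ degD] := cD.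
apply: (open_stable_words PE) => u h v.
have [h0|h0] := pselect (lval h = 0).
  rewrite (letter_linear0 (z := h) (@lword_multilinearr _ _ _ u [::] v)) //.
  by rewrite !linear0.
have [y yh] := independent_letter dim1 h0.
have [lam [lamh lamy]] := separating_functional yh.
have [Phi [Psi [PhiE PsiE PhiPsi]]] := flip_ex PE DeltaE poE lam.
pose w := h :: v ++ [:: y].
(* The terms in which [D] consumes all open letters of [w] and returns the letter seen by [lam]. *)
pose S a b : C := sg (deg a) *: ((lam (po (D (lword b w))) : k) *: P (lword a [::])).
have Pnz a z x : P (lword a (z :: x)) = 0 by rewrite PE scale0r.
have lpo0 a x : (size a + size x != 1)%N -> lam (po (lword a x)) = 0.
  rewrite poE => sz; case: a sz => [|? ?] sz; last exact: linear0.
  by case: x sz => [|? [|? ?]] //= _; exact: linear0.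
have w_last : w = (h :: v) ++ [:: y] by [].
have csum_last (F : seq (letter Ho) -> seq (letter Ho) -> C) :
    (forall x q, size q != 1%N -> F x q = 0) -> csum w F = F (h :: v) [:: y].
  move=> F0; rewrite w_last csum_cat csum_extremer => [|a z b]; first by rewrite /= (F0 _ [::]) // addr0.
  by rewrite F0 // size_cat addn1.
have csum_first (F : seq (letter Ho) -> seq (letter Ho) -> C) :
    (forall x q, size x != 1%N -> F x q = 0) -> csum w F = F [:: h] (v ++ [:: y]).
  move=> F0; rewrite /w /= (F0 [::]) // add0r csum_extremel // => z a b.
  exact: F0.
have PhiD : Phi (Delta (D (lword u w))) = P (D (lword u (h :: v))) + usum u S.
  rewrite cw // usum_linear.
  transitivity (usum u (fun a b => csum w (fun x q =>
       sg (deg b * deg x) *: ((lam (po (lword b q)) : k) *: P (D (lword a x)))))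
    + usum u (fun a b => csum w (fun x q =>
       sg (deg b * deg x + (deg a + deg x))
       *: ((lam (po (D (lword b q))) : k) *: P (lword a x))))).
    rewrite -usumD; apply: eq_usum => a b _ _; rewrite csum_linear -csumD.
    apply: eq_csum => x q _.
    by rewrite (linearZ_LR Phi) (linearD Phi) (linearZ_LR Phi) !PhiE scalerDr sgZZ mul1r.
  congr (_ + _).
    rewrite usum_extremer => [|a z b]; last first.
      rewrite -[RHS](csum0 _ w); apply: eq_csum => x q _.
      by rewrite poE linear0 scale0r scaler0.
    rewrite csum_last => [|x q q1]; last by rewrite lpo0 // scale0r scaler0.
    by rewrite deg_nil mul0r sg0Z poE lamy scale1r.
  apply: eq_usum => a b _ _; rewrite csum_extremel => [|z x q]; last by rewrite Pnz !scaler0.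
  by rewrite deg_nil mulr0 addr0 add0r.
have PsiD : Psi (Delta (D (lword u w))) = usum u S.
  rewrite cw // usum_linear.
  transitivity (usum u (fun a b => csum w (fun x q =>
       sg (deg b * deg x + (deg a + deg x + 1) * (deg b + deg q))
       *: ((lam (po (D (lword a x))) : k) *: P (lword b q))))
    + usum u (fun a b => csum w (fun x q =>
       sg (deg b * deg x + (deg a + deg x) + (deg a + deg x) * (deg b + deg q + 1))
       *: ((lam (po (lword a x)) : k) *: P (D (lword b q)))))).
    rewrite -usumD; apply: eq_usum => a b _ _; rewrite csum_linear -csumD.
    apply: eq_csum => x q _.
    have [da db] := (lword_deg a x, lword_deg b q).
    rewrite (linearZ_LR Psi) (linearD Psi) (linearZ_LR Psi).
    rewrite (PsiE _ _ _ _ (degD _ _ da) db) (PsiE _ _ _ _ da (degD _ _ db)).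
    by rewrite scalerDr !sgZZ mul1r.
  rewrite [X in _ + X](_ : _ = 0) ?addr0; last first.
    rewrite usum_extremel => [|z a b]; last first.
      rewrite -[RHS](csum0 _ w); apply: eq_csum => x q _.
      by rewrite poE linear0 scale0r scaler0.
    rewrite csum_first => [|x q x1]; last by rewrite lpo0 // scale0r scaler0.
    by rewrite poE lamh scale0r scaler0.
  (* [Psi] finds the letter in the first factor, so the two closed blocks of [S] are exchanged. *)
  rewrite [RHS]usum_swap; apply: eq_usum => a b _ _.
  rewrite csum_extremer => [|x z q]; last by rewrite Pnz !scaler0.
  by rewrite /S sgZZ deg_nil; signs.
apply: (addIr (usum u S)); by rewrite -PhiD PhiPsi PsiD add0r.
Qed.
End NotOneDimensional.

(** * The correspondence *)

Section Correspondence.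
Variables (k : fieldType) (Hc Ho : gradedSpace k).
Local Notation C := (coalg Hc Ho).
Local Notation lword := (@lword k Hc Ho).
Hypothesis char0 : [pchar k] =i pred0.
Variables (Delta : {linear C -> tensor C C}) (eps : {linear C -> k^o}).
Hypothesis DeltaE : is_lcoproduct Delta.
Hypothesis epsE : forall u v, eps (lword u v) = (nilp u && nilp v)%:R.
Variables (pc : {linear C -> Hc}) (po : {linear C -> Ho}).
Hypothesis pcE : forall u v, pc (lword u v)
  = if v is [::] then if u is [:: x] then lval x else 0 else 0.
Hypothesis poE : forall u v, po (lword u v)
  = if u is [::] then if v is [:: x] then lval x else 0 else 0.

(** [is_counit] speaks of arbitrary vectors; multilinearity in each list of letters reduces it to
    homogeneous ones. *)
Lemma counit_words : is_counit eps.
Proof.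
move=> u v.
have mlo a : multilinear (fun y : seq Ho => eps (word (vals a) y)).
  by move=> p q c x y; rewrite (word_multilinearr (vals a)) linearP.
have mlc y : multilinear (fun a : seq Hc => eps (word a y)).
  by move=> p q c x x'; rewrite (word_multilinearl y) linearP.
have := multilinear_eq (mlc v) (g := fun a => (nilp a && nilp v)%:R : k^o); apply.
  by move=> [|? p] q c x y; rewrite scaler0 addr0.
move=> a; have := multilinear_eq (mlo a) (g := fun y => (nilp (vals a) && nilp y)%:R : k^o); apply.
  by move=> [|? p] q c x y; rewrite /= andbF scaler0 addr0.
by move=> y; rewrite -[word _ _]/(lword a y) epsE; case: a; case: y.
Qed.

Section Lift.
Variables (l : seq Hc -> Hc) (n : seq Hc -> seq Ho -> Ho).
Hypotheses (Hl : closed_ops l) (Hn : open_ops n).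

Lemma lift_word_counit (D : {linear C -> C}) u v :
  is_lift_word Hl Hn D -> eps (D (lword u v)) = 0.
Proof.
move=> ->; rewrite linearD !usum_linear.
rewrite -[RHS]addr0; congr (_ + _).
  by rewrite -[RHS](usum0 _ u); apply: eq_usum => a b _ _; rewrite epsE.
rewrite -[RHS](usum0 _ u); apply: eq_usum => a b _ _.
rewrite csum_linear -[RHS](csum0 _ v); apply: eq_csum => x yz _.
rewrite csum_linear -[RHS](csum0 _ yz); apply: eq_csum => y z _.
by rewrite linearZ /= epsE; case: x => [|? ?]; rewrite andbF scaler0.
Qed.

Lemma lift_word_unit (D : {linear C -> C}) :
  is_lift_word Hl Hn D -> D (word [::] [::]) = 0.
Proof.
have [[l0 _ _ _] [n0 _ _ _]] := (Hl, Hn).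
move=> DE; rewrite [LHS](DE [::] [::]) /closed_lift_word /open_lift_word /=.
rewrite /lword /= l0 n0 (multilinear0 [::] [::] (word_multilinearl [::])).
by rewrite (multilinear0 [::] [::] (word_multilinearr [::])) scaler0 addr0.
Qed.

Lemma lift_word_open_stable (D : {linear C -> C}) :
  is_lift_word Hl Hn D -> open_stable D.
Proof.
move=> DE; have [P PE] := size_scaling_ex Hc Ho (fun _ n => (n == 0)%:R).
apply: (open_stable_words PE) => u y v.
rewrite DE linearD !usum_linear -[RHS]addr0; congr (_ + _).
  by rewrite -[RHS](usum0 _ u); apply: eq_usum => a b _ _; rewrite PE scale0r.
rewrite -[RHS](usum0 _ u); apply: eq_usum => a b _ _.
rewrite csum_linear -[RHS](csum0 _ (y :: v)); apply: eq_csum => x yz _.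
rewrite csum_linear -[RHS](csum0 _ yz); apply: eq_csum => p q _.
by rewrite linearZ /= PE size_cat addnS scale0r scaler0.
Qed.

Lemma lift_word_coder1 (D : {linear C -> C}) : is_lift_word Hl Hn D -> coder1 Delta eps D.
Proof.
move=> DE; have [Dc [Do [DcE DoE]]] := lift_word_ex Hl Hn.
apply: coder_word_coder1 => // [|u v|u v].
- have cDc := closed_lift_coder DeltaE DcE; have cDo := open_lift_coder DeltaE DoE.
  apply: (coder_word_comb (c := 1) _ cDc cDo) => x; rewrite scale1r.
  have [F FE] := linear_add_ex Dc Do; rewrite -FE; apply: coalg_eq => u v.
  by rewrite FE DcE DoE DE.
- exact: (lift_word_counit u v DE).
- exact: (lift_word_deg u v DE).
Qed.

Lemma lift_word_square (D : {linear C -> C}) : is_lift_word Hl Hn D ->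
  ocha_relations l n <-> (forall x, D (D x) = 0).
Proof.
move=> DE; split=> [[/(Linfty_relationsP Hl) rl /(open_closed_relationsP Hl Hn) ro]|D2].
  have cD2 := coder_square DeltaE (lift_word_coder1 DE).
  have D2w : forall u v, D (D (lword u v)) = 0.
    apply: (coder_word_eq0 DeltaE char0 pcE poE cD2) => u v.
      by rewrite (pc_lift2 pcE DE); case: v.
    by rewrite (po_lift2 poE DE).
  have [F FE] := linear_comp_ex D D.
  by move=> x; rewrite -FE; apply: (span_eq (g := \0 : {linear C -> C}) _ (coalg_span x))
     => _ [u [v ->]]; rewrite FE D2w.
split; [apply/(Linfty_relationsP Hl) => u | apply/(open_closed_relationsP Hl Hn) => u v].
  by rewrite -[LHS](pc_lift2 pcE DE u [::]) D2 linear0.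
by rewrite -(po_lift2 poE DE) D2 linear0.
Qed.

Lemma lift_word_exists : exists D : {linear C -> C}, is_lift_word Hl Hn D.
Proof.
have [Dc [Do [DcE DoE]]] := lift_word_ex Hl Hn.
by have [D DE] := linear_add_ex Dc Do; exists D => u v; rewrite DE DcE DoE.
Qed.
End Lift.

(** * Recovering the operations from a coderivation *)

Section Corestriction.
Variable D : {linear C -> C}.
Hypotheses (cD : coder1 Delta eps D) (D1 : D (word [::] [::]) = 0) (oD : open_stable D).

Definition closed_corestriction (u : seq Hc) : Hc := pc (D (word u [::])).
Definition open_corestriction (u : seq Hc) (v : seq Ho) : Ho := po (D (word u v)).

Lemma proj_deg (H : gradedSpace k) (p : {linear C -> H}) e x :
  (forall u v, gdeg (deg u + deg v) (p (lword u v))) -> coalg_deg e x -> gdeg e (p x).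
Proof.
move=> pd; elim=> [|c _ z [du [u [dv [v [hu hv de ->]]]]] _ IH].
  by rewrite linear0; exact: gdeg0.
have [[w [wd wv]] [t [td tv]]] := (homogeneous_letters hu, homogeneous_letters hv).
rewrite linearP; apply: gdegP IH; have := pd w t.
by rewrite /deg wd td de /lword wv tv.
Qed.

Lemma pc_deg u v : gdeg (deg u + deg v) (pc (lword u v)).
Proof.
rewrite pcE; case: v => [|y v]; last exact: gdeg0.
case: u => [|x [|x' u]]; try exact: gdeg0.
by rewrite deg_cons !deg_nil !addr0; exact: lhom.
Qed.

Lemma po_deg u v : gdeg (deg u + deg v) (po (lword u v)).
Proof.
rewrite poE; case: u => [|y u]; last exact: gdeg0.
case: v => [|x [|x' v]]; try exact: gdeg0.
by rewrite deg_cons !deg_nil addr0 add0r; exact: lhom.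
Qed.

Lemma D_deg u v d e : homogeneous d u -> homogeneous e v ->
  coalg_deg (degsum d + degsum e + 1) (D (word u v)).
Proof.
move=> hu hv; case: cD => _ _; apply.
by apply: span_gen; exists d, u, e, v.
Qed.

Lemma closed_corestriction_ops : closed_ops closed_corestriction.
Proof.
split.
- by rewrite /closed_corestriction D1 linear0.
- by move=> a b c x y; rewrite /closed_corestriction (word_multilinearl [::]) !linearP.
- apply: letters_graded_symmetric; have [F FE] := linear_comp_ex D pc.
  move=> a b x y; rewrite /closed_corestriction -!FE.
  exact: (lsymmetric_linear F (@lword_symmetricl _ _ _ [::])).
move=> d v hv; have h0 : homogeneous ([::] : seq int) ([::] : seq Ho) by [].
have := proj_deg pc_deg (D_deg hv h0); rewrite {2}/degsum big_nil addr0.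
by [].
Qed.

Lemma open_corestriction_ops : open_ops open_corestriction.
Proof.
have ml a : multilinear (open_corestriction^~ a).
  by move=> p q c x y; rewrite /open_corestriction (word_multilinearl a) !linearP.
split=> [|a|v|d v e a hv ha].
- by rewrite /open_corestriction D1 linear0.
(* The open entries are arbitrary here, so both sides are compared as multilinear functions of
   them. *)
- split=> //; apply: letters_graded_symmetric => p q x y.
  pose f (b : seq Ho) := open_corestriction (vals (p ++ x :: y :: q)) b.
  pose g (b : seq Ho) := sg (ldeg x * ldeg y) *: open_corestriction (vals (p ++ y :: x :: q)) b.
  have mo u : multilinear (open_corestriction u).
    by move=> p' q' c x' y'; rewrite /open_corestriction (word_multilinearr u) !linearP.
  have [F FE] := linear_comp_ex D po.
  apply: (multilinear_eq (f := f) (g := g)) => [|p' q' c x' y'|w]; first exact: mo.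
    by rewrite /g mo scalerDr !scalerA mulrC.
  rewrite /f /g /open_corestriction -!FE.
  exact: (lsymmetric_linear F (@lword_symmetricl _ _ _ w)).
- by move=> p' q' c x' y'; rewrite /open_corestriction (word_multilinearr v) !linearP.
exact: proj_deg po_deg (D_deg hv ha).
Qed.

Lemma pc_open_part x : open_part x -> pc x = 0.
Proof.
elim=> [|c _ z [u [v [v0 ->]]] _ IH]; first exact: linear0.
rewrite linearP IH addr0 [pc _](_ : _ = 0) ?scaler0 //.
apply: (span_eq (g := \0 : {linear C -> Hc}) _ (word_lword_span u v)) => _ [a [t [tv ->]]].
by rewrite pcE; case: t tv => // /esym/size0nil.
Qed.

(** The difference of [D] and the lift [D'] of its components is a coderivation without letter
    components. On words with an open letter, [D'] has no component in Hc by construction, and [D]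
    has none by open stability. *)
Lemma corestriction_lift : is_lift closed_corestriction open_corestriction D.
Proof.
have [D' D'E] := lift_word_exists closed_corestriction_ops open_corestriction_ops.
have cD' := lift_word_coder1 D'E.
have E0 : forall u v, -1 *: D' (lword u v) + D (lword u v) = 0.
  apply: (coder_word_eq0 DeltaE char0 pcE poE (E := fun x => -1 *: D' x + D x)).
  - by apply: (coder_word_comb _ (coder1_word DeltaE cD') (coder1_word DeltaE cD)).
  - move=> u v; rewrite linearP (pc_lift pcE D'E).
    case: v => [|y v]; first by rewrite scaleN1r addNr.
    rewrite scaler0 add0r pc_open_part //; apply: oD; apply: span_gen.
    by exists (vals u), (vals (y :: v)).
  - by move=> u v; rewrite linearP (po_lift poE D'E) scaleN1r addNr.
apply/(is_liftP closed_corestriction_ops open_corestriction_ops) => u v.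
by rewrite -D'E; apply/eqP; rewrite -subr_eq0 addrC -scaleN1r E0.
Qed.

(** The components of a lift give back the operations on homogeneous letters, and multilinearity
    extends the equality to all lists. *)
Lemma corestriction_unique l n : ocha_ops l n -> is_lift l n D ->
  closed_corestriction = l /\ open_corestriction = n.
Proof.
move=> [Hl Hn] /(is_liftP Hl Hn) DE.
have [_ mlc _ _] := closed_corestriction_ops; have [_ mln mno _] := open_corestriction_ops.
have [_ ml _ _] := Hl; have [_ mn mn' _] := Hn.
split; apply/funext => u.
  apply: multilinear_eq => // w.
  by rewrite -[RHS](pc_lift pcE DE w [::]).
apply/funext => v.
apply: (multilinear_eq (f := open_corestriction^~ v) (g := n^~ v)).
- by case: (mln v).
- by case: (mn v).
move=> w; apply: multilinear_eq => // t.
by rewrite -(po_lift poE DE).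
Qed.
End Corestriction.
End Correspondence.

Theorem theorem1 (k : fieldType) (char0 : [pchar k] =i pred0)
    (Hc Ho : gradedSpace k) :
  exists (Delta : {linear coalg Hc Ho -> tensor (coalg Hc Ho) (coalg Hc Ho)})
         (eps : {linear coalg Hc Ho -> k^o}),
  [/\ is_coproduct Delta,
      is_counit eps,
      forall (l : seq Hc -> Hc) (n : seq Hc -> seq Ho -> Ho), ocha_ops l n ->
        exists D : {linear coalg Hc Ho -> coalg Hc Ho},
          [/\ is_lift l n D,
              forall D' : {linear coalg Hc Ho -> coalg Hc Ho},
                is_lift l n D' -> D' =1 D,
              coder1 Delta eps D
            & ocha_relations l n <-> (forall x, D (D x) = 0)],
      forall D : {linear coalg Hc Ho -> coalg Hc Ho},
        coder1 Delta eps D -> (forall x, D (D x) = 0) ->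
        (exists! ln : (seq Hc -> Hc) * (seq Hc -> seq Ho -> Ho),
           ocha ln.1 ln.2 /\ is_lift ln.1 ln.2 D)
        <-> (D (word [::] [::]) = 0 /\ open_stable D)
    & ~ one_dimensional Ho ->
        forall D : {linear coalg Hc Ho -> coalg Hc Ho},
          coder1 Delta eps D -> open_stable D].
Proof.
have [Delta DeltaE] := coproduct_ex Hc Ho.
have [eps epsE] := counit_ex Hc Ho.
have [pc pcE] := closed_letter_proj Hc Ho.
have [po poE] := open_letter_proj Hc Ho.
exists Delta, eps; split.
- exact: lcoproductP.
- exact: counit_words.
- move=> l n [Hl Hn]; have [D DE] := lift_word_exists Hl Hn.
  exists D; split.
  + exact/(is_liftP Hl Hn).
  + move=> D' /(is_liftP Hl Hn) D'E; apply: coalg_eq => u v.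
    by rewrite D'E DE.
  + exact: (lift_word_coder1 DeltaE epsE DE).
  + exact: (lift_word_square char0 DeltaE epsE pcE poE DE).
- move=> D cD D2; split=> [[[l n] [[[[Hl Hn] _] /(is_liftP Hl Hn) DE] _]]|[D1 oD]].
    by split; [exact: lift_word_unit DE | exact: lift_word_open_stable DE].
  have Hl := closed_corestriction_ops pcE cD D1.
  have Hn := open_corestriction_ops poE cD D1.
  have liftD := corestriction_lift char0 DeltaE epsE pcE poE cD D1 oD.
  exists (closed_corestriction pc D, open_corestriction po D); split=> /= [|[l n] /= [[ops _] lD]].
    split=> //; split=> //; move/(is_liftP Hl Hn): liftD => DE.
    by rewrite (lift_word_square char0 DeltaE epsE pcE poE DE).
  by have [-> ->] := corestriction_unique pcE poE cD D1 ops lD.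
- by move=> dim1 D; exact: coder1_open_stable.
Qed.
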